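(* Let $\phi$ be an analytic self-map of $\mathbb{C}_+$ such that the composition operator $C_\phi f=f\circ\phi$ is bounded on $H^2(\mathbb{C}_+)$. Let $J:H^2(\mathbb{C}_+)\to H^2(\mathbb{C}_+)$ be the conjugation $(Jf)(w)=\overline{f(\overline{w})}$. Then $C_\phi$ is $J$-symmetric if and only if $\phi$ is a parabolic symbol, that is, $\phi(w)=w+b$ for all $w\in\mathbb{C}_+$, for some $b\in\mathbb{C}$ with $\mathrm{Re}(b)\ge 0$ and $b\neq 0$.
   Context: $\mathbb{C}_+=\{z\in\mathbb{C}:\mathrm{Re}(z)>0\}$. $H^2(\mathbb{C}_+)$ is the Hilbert space of analytic functions $f$ on $\mathbb{C}_+$ with $\|f\|=\left(\sup_{0<x<\infty}\frac{1}{\pi}\int_{-\infty}^{\infty}|f(x+iy)|^2\,dy\right)^{1/2}<\infty$. The map $\phi$ is called the symbol of $C_\phi$. A self-map $\phi(w)=aw+b$ of $\mathbb{C}_+$ with $a>0$ and $\mathrm{Re}(b)\ge 0$ is called parabolic if $a=1$ (and necessarily $b\neq 0$). A conjugation on a Hilbert space $\mathcal{H}$ is a conjugate-linear operator $C$ with $C^2=I$ and $\langle Cx,Cy\rangle=\langle y,x\rangle$ for all $x,y\in\mathcal{H}$. A bounded operator $T$ is $C$-symmetric if $CT^*C=T$.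
   Formalization: The formal theorem assumes in addition that φ is not the identity map, since for φ(w)=w the operator C_φ=I is J-symmetric while φ is not parabolic (b≠0 fails). *)

(* Defs.v *)
From HB Require Import structures.
From mathcomp Require Import all_boot all_order all_algebra.
From mathcomp Require Import complex.
From mathcomp Require Import all_classical all_reals all_analysis.
Set Implicit Arguments.
Unset Strict Implicit.
Unset Printing Implicit Defensive.
Import Order.TTheory GRing.Theory Num.Theory.
Import numFieldNormedType.Exports.
Import ComplexField.
Local Open Scope classical_set_scope.
Local Open Scope ring_scope.
Local Open Scope complex_scope.

(* A function on the right half-plane is represented by a total function
   R[i] -> R[i] whose values outside Cplus are irrelevant: all the notions below
   only look at values on Cplus, and equality of functions is equality on
   Cplus. *)

Section HardySpace.
Variable R : realType.
Local Notation C := (R[i]).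

Definition Cplus : set C := [set z | 0 < complex.Re z].

(* The scalar field of the normed module C^o is C, so that derivable along 1 is
   complex differentiability. *)
Definition analytic_on_Cplus (f : C -> C) :=
  forall z, Cplus z -> derivable (f : C^o -> C^o) z 1.

Definition hardy_norm2 (f : C -> C) : \bar R :=
  ereal_sup [set ((pi^-1)%:E *
      \int[lebesgue_measure]_y (Normc.normc (f (x +i* y)) ^+ 2)%:E)%E
    | x in [set x : R | 0 < x]].

Definition H2 : set (C -> C) :=
  [set f | analytic_on_Cplus f /\ (hardy_norm2 f < +oo)%E].

Definition H2norm (f : C -> C) : R := Num.sqrt (fine (hardy_norm2 f)).

(* The inner product, linear in f and conjugate-linear in g, recovered from the
   norm by the polarization identity:
   4 <f, g> = |f + g|^2 - |f - g|^2 + i |f + i g|^2 - i |f - i g|^2. *)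
Definition H2dot (f g : C -> C) : C :=
  let q (c : C) : R := H2norm (fun z => f z + c * g z) ^+ 2 in
  ((q 1 - q (- 1)) / 4) +i* ((q 'i%C - q (- 'i%C)) / 4).

Definition H2bounded (T : (C -> C) -> (C -> C)) :=
  (forall f, H2 f -> H2 (T f)) /\
  exists M : R, forall f, H2 f -> H2norm (T f) <= M * H2norm f.

(* S acts on H2 as the Hilbert space adjoint of T; such an S is automatically
   linear and bounded, and its values on H2 are determined on Cplus. *)
Definition is_adjoint (T S : (C -> C) -> (C -> C)) :=
  (forall f, H2 f -> H2 (S f)) /\
  forall f g, H2 f -> H2 g -> H2dot (T f) g = H2dot f (S g).

(* K T^* K = T on H2. *)
Definition symmetric_wrt (K T : (C -> C) -> (C -> C)) :=
  exists2 S, is_adjoint T S &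
    forall f w, H2 f -> Cplus w -> K (S (K f)) w = T f w.

Definition comp_op (phi : C -> C) (f : C -> C) : C -> C := f \o phi.

Definition J (f : C -> C) : C -> C := fun w => (f w^*)^*.

Definition parabolic (phi : C -> C) :=
  exists b : C, [/\ 0 <= complex.Re b, b <> 0 &
    forall w, Cplus w -> phi w = w + b].

End HardySpace.

(* Main.v *)
(* The pairing of f and g in H^2 is the limit, as x decreases to 0, of
   (1/pi) int f(x+iy) conj(g(x+iy)) dy: writing conj(g(x'+iy)) as an analytic
   function of x+iy, Cauchy's theorem on a vertical strip shows that
   int f(x+iy) conj(g(x'+iy)) dy depends only on x + x', so that the squared
   norms on vertical lines are midpoint convex and, being bounded, nonincreasing
   in x.  The same shift shows that the adjoint of f |-> f(_ + b) is
   g |-> g(_ + conj b), which gives J-symmetry of parabolic symbols.  Conversely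
   the reproducing kernels k_a(w) = 1 / (w + conj a), for which
   <f, k_a> = 2 f(a), turn J-symmetry into
   1 / (phi(b) + conj a) = 1 / (phi(conj a) + b), so that
   phi(b) - b = phi(conj a) - conj a for all a and b. *)

From HB Require Import structures.
Require Import Defs.
From mathcomp Require Import all_boot all_order all_algebra.
From mathcomp Require Import complex.
From mathcomp Require Import all_classical all_reals all_analysis.
From mathcomp Require Import measurable_realfun.
From mathcomp Require Import ring lra.
Set Implicit Arguments.
Unset Strict Implicit.
Unset Printing Implicit Defensive.
Import Order.TTheory GRing.Theory Num.Theory.
Import numFieldNormedType.Exports.
Local Open Scope classical_set_scope.
Local Open Scope ring_scope.

(** * Circulation of plane forms *)

(** No boundary functions on the imaginary axis are constructed: each identity is proved on a line
    [Re z = x] with [x > 0], and [x] tends to 0 only at the end. Monotonicity makes this possible: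
    it turns the supremum defining the norm into a limit, so that polarization, which is exact on
    each line, passes to [H2dot]. Analyticity here means pointwise differentiability, so Cauchy's
    theorem is obtained by Goursat's subdivision, for the real form Im F dx + Re F dy, the imaginary
    part of F dz. Only real parts of pairings are computed; multiplying one argument by i gives the
    imaginary parts. On the line [Re z = x] the conjugate of k_a(z) is 1 / (a + 2x - z), whose pole
    p = a + 2x lies in the half-plane. Instead of computing a residue, one subtracts from f the
    multiple of k_a that makes the difference vanish at p. The quotient then has a removable point,
    which is why Cauchy's theorem is needed with an exceptional point, and the difference is
    orthogonal to k_a. Hence the pairing of f and k_a on the line comes from the norm of k_a alone;
    its value 2 pi f(a + 2x) explains the factor 2. *)

Section RealPlane.
Variable R : realType.
Implicit Types (P Q : R -> R -> R) (a b c d x y e : R).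
Local Notation mu := (@lebesgue_measure R).

Definition jcont P := forall x y e, 0 < e -> exists2 d, 0 < d &
  forall x' y', `|x' - x| <= d -> `|y' - y| <= d -> `|P x' y' - P x y| <= e.

Lemma jcont_continuous P : jcont P -> continuous (fun z : R * R => P z.1 z.2).
Proof.
move=> cP [x y]; apply/cvgrPdist_le => e e0 /=.
have [d d0 Pd] := cP x y e e0.
exists (ball x d, ball y d) => [|[x' y'] [/= xx' yy']].
  by split; exact: (@nbhsx_ballx _ R).
by rewrite distrC; apply: Pd; rewrite distrC; exact: ltW.
Qed.

Lemma jcont_section P x : jcont P -> continuous (P x).
Proof.
move=> cP y; apply/cvgrPdist_le => e e0 /=.
have [d d0 Pd] := cP x y e e0.
near=> z; rewrite distrC; apply: Pd; first by rewrite subrr normr0 ltW.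
rewrite distrC ltW//; near: z; exact: (@nbhsx_ballx _ R).
Unshelve. all: end_near. Qed.

Lemma jcont_swap P : jcont P -> jcont (fun x y => P y x).
Proof.
move=> cP x y e e0; have [d d0 Pd] := cP y x e e0.
by exists d => // x' y' x'd y'd; exact: Pd.
Qed.

Lemma jcont_bounded P a b c d : jcont P ->
  exists2 M, 0 < M &
    forall x y, a <= x <= b -> c <= y <= d -> `|P x y| <= M.
Proof.
move=> /jcont_continuous cP.
have cK : compact (`[a, b] `*` `[c, d] : set (R * R)).
  by apply: compact_setX; exact: segment_compact.
have := @continuous_compact _ _ (fun z : R * R => P z.1 z.2) _ (continuous_subspaceT cP) cK.
move=> /compact_bounded [M [Mr HM]].
exists (`|M| + 1); first by rewrite ltr_wpDl.
move=> x y xab ycd; apply: (HM (`|M| + 1)).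
  by rewrite (le_lt_trans (ler_norm _))// ltrDl.
by exists (x, y) => //; split => /=; rewrite in_itv.
Qed.

(** The sigma-algebra on [R * R] is the product one, so the open preimage of a ray has to be
    exhibited as a countable union of squares with rational centre and radius. *)
Lemma jcont_measurable P : jcont P ->
  measurable_fun [set: R * R] (fun z : R * R => P z.1 z.2).
Proof.
move=> cP.
apply: (measurability _ (RGenOInfty.measurableE R)) => //.
move=> _ [_ [r ->] <-]; rewrite setTI.
pose F (q : rat * rat * rat) : set (R * R) :=
  [set z | (`|z.1 - ratr q.1.1| < ratr q.2) && (`|z.2 - ratr q.1.2| < ratr q.2)].
have mF q : measurable (F q).
  have -> : F q = ball (ratr q.1.1 : R) (ratr q.2) `*` ball (ratr q.1.2 : R) (ratr q.2).
    by apply/seteqP; split => z /=; rewrite /F /ball /= (distrC z.1) (distrC z.2) => /andP.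
  by rewrite !ball_itv; apply: measurableX; exact: measurable_itv.
pose G (q : rat * rat * rat) : set (R * R) :=
  if `[< F q `<=` [set z | r < P z.1 z.2] >] then F q else set0.
have -> : (fun z : R * R => P z.1 z.2) @^-1` `]r, +oo[%classic = \bigcup_q G q.
  apply/seteqP; split => [[x y]|z] /=; last first.
    case=> q _; rewrite /G; case: asboolP => // + Fz => /(_ z Fz) /=.
    by rewrite in_itv/= andbT.
  rewrite in_itv/= andbT => rP.
  have [d d0 Pd] := cP x y ((P x y - r) / 2) ltac:(lra).
  (* A square of radius [s] whose centre is within [s] of [(x, y)] stays within [2 * s < d] of
     it. *)
  have [s /andP[s0 sd]] : exists s : rat, 0 < (ratr s : R) < d / 2.
    have [s] := rat_in_itvoo (divr_gt0 d0 (ltr0n _ 2)).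
    by rewrite in_itv/=; exists s.
  have [p] := @rat_in_itvoo R (x - ratr s) (x + ratr s) ltac:(lra).
  rewrite in_itv/= => /andP[p1 p2].
  have [q] := @rat_in_itvoo R (y - ratr s) (y + ratr s) ltac:(lra).
  rewrite in_itv/= => /andP[q1 q2].
  exists (p, q, s) => //; rewrite /G ifT.
    by rewrite /F/= !ltr_norml; apply/andP; split; apply/andP; split; lra.
  apply/asboolP => -[x' y'] /=; rewrite /F /= => /andP[].
  rewrite !ltr_norml => /andP[? ?] /andP[? ?].
  have : `|P x' y' - P x y| <= (P x y - r) / 2.
    by apply: Pd; rewrite ler_norml; apply/andP; split; lra.
  by rewrite ler_norml => /andP[]; lra.
apply: countable_bigcupT_measurable => // q.
by rewrite /G; case: ifP.
Qed.

Definition segint a b (f : R -> R) := \int[mu]_(t in `[a, b]) f t.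

Lemma segint_integrable a b f : continuous f -> mu.-integrable `[a, b] (EFin \o f).
Proof.
move=> cf; apply: continuous_compact_integrable; first exact: segment_compact.
exact: continuous_subspaceT.
Qed.

Lemma segint_split a x b f : continuous f -> a <= x <= b ->
  segint a b f = segint a x f + segint x b f.
Proof.
move=> cf /andP[ax xb]; rewrite /segint.
have := @Rintegral_itvB R f (BLeft a) (BRight b) x (segint_integrable _ _ cf).
rewrite !bnd_simp => /(_ ax xb) => H.
have <- : \int[mu]_(t in `]x, b]) f t = \int[mu]_(t in `[x, b]) f t.
  apply: Rintegral_itv_obnd_cbnd; apply: integrableS (segint_integrable _ _ cf) => //.
  exact: subset_itv_oc_cc.
by rewrite -H addrC subrK.
Qed.

Lemma segint_cst a b k : a <= b -> segint a b (fun=> k) = k * (b - a).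
Proof.
move=> ab; rewrite /segint Rintegral_cst//= lebesgue_measure_itv/= lte_fin.
move: ab; rewrite le_eqVlt => /predU1P[->|->] //=.
by rewrite ltxx subrr.
Qed.

Lemma segint_bound a b f M : continuous f -> a <= b ->
  (forall t, a <= t <= b -> `|f t| <= M) -> `|segint a b f| <= M * (b - a).
Proof.
move=> cf ab fM; rewrite /segint.
apply: (le_trans (le_normr_Rintegral _ (segint_integrable _ _ cf))) => //.
rewrite -segint_cst//.
apply: le_Rintegral => //.
- apply: (@segint_integrable a b (fun t => `|f t|)) => t.
  apply: (@continuous_comp _ _ _ f (fun x : R => `|x|)); first exact: cf.
  exact: norm_continuous.
- by apply: segint_integrable; exact: cst_continuous.
Qed.

Lemma segintB a b f g : continuous f -> continuous g ->
  segint a b (fun t => f t - g t) = segint a b f - segint a b g.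
Proof. by move=> cf cg; apply: RintegralB => //; exact: segint_integrable. Qed.

(* The circulation of the 1-form [P dx + Q dy] around a rectangle. *)
Definition circ P Q a b c d :=
  (segint c d (Q b) - segint c d (Q a)) -
  (segint a b (P ^~ d) - segint a b (P ^~ c)).

Lemma circ_splitx P Q a x b c d : jcont P -> jcont Q -> a <= x <= b ->
  circ P Q a b c d = circ P Q a x c d + circ P Q x b c d.
Proof.
move=> cP cQ axb; rewrite /circ !(@segint_split a x b)//; first lra.
- by apply: jcont_section (jcont_swap cP).
- by apply: jcont_section (jcont_swap cP).
Qed.

Lemma circ_splity P Q a b c y d : jcont P -> jcont Q -> c <= y <= d ->
  circ P Q a b c d = circ P Q a b c y + circ P Q a b y d.
Proof.
move=> cP cQ cyd; rewrite /circ !(@segint_split c y d)//; first lra.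
- exact: jcont_section.
- exact: jcont_section.
Qed.

Lemma circ_bound P Q a b c d M : jcont P -> jcont Q -> a <= b -> c <= d ->
  (forall x y, a <= x <= b -> c <= y <= d -> `|P x y| <= M) ->
  (forall x y, a <= x <= b -> c <= y <= d -> `|Q x y| <= M) ->
  `|circ P Q a b c d| <= 2 * M * ((b - a) + (d - c)).
Proof.
move=> cP cQ ab cd PM QM.
have H1 x : a <= x <= b -> `|segint c d (Q x)| <= M * (d - c).
  move=> xab; apply: segint_bound => //; first exact: jcont_section.
  by move=> t tcd; exact: QM.
have H2 y : c <= y <= d -> `|segint a b (P ^~ y)| <= M * (b - a).
  move=> ycd; apply: segint_bound => //; first exact: jcont_section (jcont_swap cP).
  by move=> t tab; exact: PM.
have := H1 a; have := H1 b; have := H2 c; have := H2 d; rewrite /circ !lexx ab cd.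
move=> /(_ isT) + /(_ isT) + /(_ isT) + /(_ isT).
rewrite !ler_norml => /andP[? ?] /andP[? ?] /andP[? ?] /andP[? ?].
by apply/andP; split; lra.
Qed.

End RealPlane.

(** * Goursat's theorem for rectangles *)

Section Goursat.
Variable R : realType.
Implicit Types (P Q : R -> R -> R) (a b c d x y e : R).

(* First-order expansion at (x0, y0), relative to the rectangle, with
   dP/dy = dQ/dx. *)
Definition closed_at P Q a b c d x0 y0 := exists al be ga, forall e, 0 < e ->
  exists2 r, 0 < r & forall x y, a <= x <= b -> c <= y <= d ->
    `|x - x0| <= r -> `|y - y0| <= r ->
    `|P x y - P x0 y0 - (al * (x - x0) + be * (y - y0))|
       <= e * (`|x - x0| + `|y - y0|) /\
    `|Q x y - Q x0 y0 - (be * (x - x0) + ga * (y - y0))|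
       <= e * (`|x - x0| + `|y - y0|).

(** Opposite sides are paired: [Q b t - Q a t] is [be * (b - a)] and [P s d - P s c] is
    [be * (d - c)], each up to [2 * e] times the half-perimeter. After integration the two terms
    [be * (b - a) * (d - c)] cancel, because the expansions share the mixed coefficient, and only
    the quadratic error is left. *)
Lemma circ_small P Q a b c d x0 y0 al be ga e : jcont P -> jcont Q ->
  0 <= e -> a <= x0 <= b -> c <= y0 <= d ->
  (forall x y, a <= x <= b -> c <= y <= d ->
    `|P x y - P x0 y0 - (al * (x - x0) + be * (y - y0))|
       <= e * (`|x - x0| + `|y - y0|) /\
    `|Q x y - Q x0 y0 - (be * (x - x0) + ga * (y - y0))|
       <= e * (`|x - x0| + `|y - y0|)) ->
  `|circ P Q a b c d| <= 2 * e * ((b - a) + (d - c)) ^+ 2.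
Proof.
move=> cP cQ e0 /andP[ax xb] /andP[cy yd] H.
have cQx x : continuous (Q x) by exact: jcont_section.
have cPy y : continuous (P ^~ y) by exact: (jcont_section (jcont_swap cP)).
have D x y : a <= x <= b -> c <= y <= d ->
    e * (`|x - x0| + `|y - y0|) <= e * ((b - a) + (d - c)).
  move=> /andP[? ?] /andP[? ?]; apply: ler_wpM2l => //.
  by apply: lerD; rewrite ler_norml; apply/andP; split; lra.
have ab : a <= b by lra.
have cd : c <= d by lra.
have aI : a <= a <= b by rewrite lexx.
have bI : a <= b <= b by rewrite lexx andbT.
have cI : c <= c <= d by rewrite lexx.
have dI : c <= d <= d by rewrite lexx andbT.
have HQ : `|segint c d (fun t => Q b t - Q a t - be * (b - a))| <=
    2 * e * ((b - a) + (d - c)) * (d - c).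
  apply: segint_bound => //.
    move=> t; apply: cvgB; last exact: cvg_cst.
    by apply: cvgB; exact: cQx.
  move=> t tcd.
  have [_] := H a t aI tcd; have [_] := H b t bI tcd.
  have := D a t aI tcd; have := D b t bI tcd.
  rewrite !ler_norml => ? ? /andP[? ?] /andP[? ?]; apply/andP; split; nra.
have HP : `|segint a b (fun s => P s d - P s c - be * (d - c))| <=
    2 * e * ((b - a) + (d - c)) * (b - a).
  apply: segint_bound => //.
    move=> t; apply: cvgB; last exact: cvg_cst.
    by apply: cvgB; exact: cPy.
  move=> t tab.
  have [+ _] := H t c tab cI; have [+ _] := H t d tab dI.
  have := D t c tab cI; have := D t d tab dI.
  rewrite !ler_norml => ? ? /andP[? ?] /andP[? ?]; apply/andP; split; nra.
move: HP HQ; rewrite !segintB//; first last.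
- exact: cst_continuous.
- by move=> t; apply: cvgB; exact: cPy.
- exact: cst_continuous.
- by move=> t; apply: cvgB; exact: cQx.
rewrite !segint_cst// /circ.
rewrite !ler_norml => /andP[? ?] /andP[? ?]; apply/andP; split; nra.
Qed.

(* Among four congruent quarters one retains a quarter of the circulation;
   iterating contradicts [circ_small] at the common point. *)
Lemma goursat P Q a b c d : jcont P -> jcont Q -> a <= b -> c <= d ->
  (forall x0 y0, a <= x0 <= b -> c <= y0 <= d -> closed_at P Q a b c d x0 y0) ->
  circ P Q a b c d = 0.
Proof.
move=> cP cQ ab cd H; apply: contrapT => /eqP; rewrite -normr_gt0.
set eta := `|_| => eta0.
have halves k : 0 <= k -> exists v : nat -> R, [/\ forall n, v n = k / 2 ^+ n,
    forall n, 0 <= v n & forall n, v n = v n.+1 + v n.+1].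
  move=> k0; exists (fun n => k / 2 ^+ n); split=> // n.
    by rewrite divr_ge0 ?exprn_ge0.
  by rewrite exprS; field; rewrite expf_neq0.
have /halves[w [wE w0 wS]] : 0 <= b - a by rewrite subr_ge0.
have /halves[h [hE h0 hS]] : 0 <= d - c by rewrite subr_ge0.
pose C n x y := circ P Q x (x + w n) y (y + h n).
pose good (s : nat * R * R) := let: (n, x, y) := s in
  [/\ a <= x, x + w n <= b, c <= y, y + h n <= d & eta / 4 ^+ n <= `|C n x y|].
(* The guard [good s] makes the relation total on all triples, as dependent choice demands; goodness
   then propagates along the chosen sequence. *)
pose rel (s t : nat * R * R) := good s -> let: (n, x, y) := s in
  let: (m, x', y') := t in
  [/\ good t, m = n.+1, x <= x' /\ x' + w m <= x + w n &
      y <= y' /\ y' + h m <= y + h n].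
have step s : {t | rel s t}.
  apply: cid; case: s => -[n x] y.
  have [Hs|Hs] := pselect (good (n, x, y)); last by exists (n, x, y) => /Hs.
  have [xa xb yc yd Cs] := Hs.
  have wSn := w0 n.+1; have hSn := h0 n.+1.
  move: (wS n) (hS n) => wn hn.
  have CE : C n x y = C n.+1 x y + C n.+1 (x + w n.+1) y +
      (C n.+1 x (y + h n.+1) + C n.+1 (x + w n.+1) (y + h n.+1)).
    rewrite /C -(addrA x) -(addrA y) -wn -hn.
    rewrite (@circ_splity R P Q x (x + w n) y (y + h n.+1))//; last first.
      by rewrite hn; lra.
    by rewrite !(@circ_splitx R P Q x (x + w n.+1) (x + w n))// wn; lra.
  have eE : eta / 4 ^+ n = 4 * (eta / 4 ^+ n.+1).
    by rewrite exprS; field; rewrite expf_neq0.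
  have : exists x' y', [/\ x' = x \/ x' = x + w n.+1,
      y' = y \/ y' = y + h n.+1 & eta / 4 ^+ n.+1 <= `|C n.+1 x' y'|].
    apply: contrapT => N.
    have K x' y' : x' = x \/ x' = x + w n.+1 -> y' = y \/ y' = y + h n.+1 ->
        `|C n.+1 x' y'| < eta / 4 ^+ n.+1.
      by move=> Hx Hy; rewrite ltNge; apply/negP => L; apply: N; exists x', y'.
    have := K x y (or_introl erefl) (or_introl erefl).
    have := K _ y (or_intror erefl) (or_introl erefl).
    have := K x _ (or_introl erefl) (or_intror erefl).
    have := K _ _ (or_intror erefl) (or_intror erefl).
    move: Cs; rewrite eE CE leNgt => /negP Cs.
    move=> k1 k2 k3 k4; apply: Cs.
    apply: le_lt_trans (ler_normD _ _) _.
    have := ler_normD (C n.+1 x y) (C n.+1 (x + w n.+1) y).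
    have := ler_normD (C n.+1 x (y + h n.+1)) (C n.+1 (x + w n.+1) (y + h n.+1)).
    by move: k1 k2 k3 k4; clear; lra.
  move=> [x' [y' [Hx Hy Cx]]]; exists (n.+1, x', y') => _.
  have [x1 x2] : x <= x' /\ x' + w n.+1 <= x + w n.
    by move: Hx wSn wn; clear => -[] ->; lra.
  have [y1 y2] : y <= y' /\ y' + h n.+1 <= y + h n.
    by move: Hy hSn hn; clear => -[] ->; lra.
  split=> //; split=> //.
  - exact: le_trans xa x1.
  - exact: le_trans x2 xb.
  - exact: le_trans yc y1.
  - exact: le_trans y2 yd.
have g0 : good (0%N, a, c).
  by rewrite /good /C wE hE !expr0 !divr1 !subrKC !lexx; split.
have [f [f0 fS]] := dependent_choice step (0%N, a, c).
have gn n : good (f n) /\ (f n).1.1 = n.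
  elim: n => [|n [gn En]]; first by rewrite f0.
  have := fS n gn; move: gn En; case: (f n) => -[m x] y; case: (f n.+1) => -[m' x'] y'.
  by move=> _ <- [? E _ _]; split.
pose X n := (f n).1.2; pose Y n := (f n).2.
have gX n : [/\ a <= X n, X n + w n <= b, c <= Y n, Y n + h n <= d &
    eta / 4 ^+ n <= `|C n (X n) (Y n)|].
  have := gn n; rewrite /X /Y; case: (f n) => -[m x] y [G /= E].
  by rewrite -E; exact: G.
have sX n : [/\ X n <= X n.+1, X n.+1 + w n.+1 <= X n + w n,
     Y n <= Y n.+1 & Y n.+1 + h n.+1 <= Y n + h n].
  have [gSn ESn] := gn n.+1; have [gfn En] := gn n.
  have := fS n gfn; rewrite /X /Y.
  move: gSn ESn gfn En; case: (f n) => -[m x] y; case: (f n.+1) => -[m' x'] y'.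
  by move=> _ /= <- _ /= <- [_ _ [? ?] [? ?]]; split.
(* Every left end is below every right end, so the supremum of the left ends lies in all the
   intervals. *)
have nested (Z v : nat -> R) : (forall n, 0 <= v n) ->
    (forall n, Z n <= Z n.+1 /\ Z n.+1 + v n.+1 <= Z n + v n) ->
    forall n, Z n <= sup (range Z) <= Z n + v n.
  move=> v0 ZS n.
  have up m k : Z m <= Z (m + k)%N /\ Z (m + k)%N + v (m + k)%N <= Z m + v m.
    elim: k => [|k [IH1 IH2]]; first by rewrite addn0.
    by rewrite addnS; have [] := ZS (m + k)%N; split; lra.
  have ubZ m : ubound (range Z) (Z m + v m).
    move=> _ [k _ <-].
    have [mk|km] := leqP m k.
      have := up m (k - m)%N; rewrite subnKC// => -[_].
      by have := v0 k; lra.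
    have := up k (m - k)%N; rewrite subnKC ?(ltnW km)// => -[+ _].
    by have := v0 m; lra.
  apply/andP; split.
    by apply: sup_upper_bound; [split; [exists (Z 0%N), 0%N|exists (Z n + v n)]|exists n].
  by apply: ge_sup => //; exists (Z 0%N), 0%N.
pose x0 := sup (range X); pose y0 := sup (range Y).
have xX : forall n, X n <= x0 <= X n + w n.
  by apply: nested => // n; have [] := sX n.
have yY : forall n, Y n <= y0 <= Y n + h n.
  by apply: nested => // n; have [] := sX n.
have x0ab : a <= x0 <= b by have := xX 0%N; have [] := gX 0%N; lra.
have y0cd : c <= y0 <= d by have := yY 0%N; have [] := gX 0%N; lra.
have [al [be [ga Hd]]] := H _ _ x0ab y0cd.
pose L := (b - a) + (d - c).
have L0 : 0 <= L by rewrite /L; lra.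
(* With this value [2 * e * L ^+ 2] is at most [eta / 2], while the retained circulation forces it
   to be at least [eta]; [L + 1] keeps the denominator positive for a degenerate rectangle. *)
pose e := eta / (4 * (L + 1) ^+ 2).
have e0 : 0 < e by rewrite divr_gt0// mulr_gt0// exprn_gt0//; lra.
have [r r0 Hr] := Hd e e0.
have [n nr] : exists n, L / 2 ^+ n <= r.
  have [n Hn] : exists n : nat, L / r < n%:R.
    by exists (Num.truncn (L / r)).+1; exact: truncnS_gt.
  exists n; rewrite ler_pdivrMr ?exprn_gt0// mulrC.
  rewrite ltr_pdivrMr// in Hn; apply: (le_trans (ltW Hn)).
  rewrite ler_pM2r// -natrX ler_nat; exact/ltnW/ltn_expl.
have wh : w n + h n = L / 2 ^+ n by rewrite wE hE /L -mulrDl.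
have [aX Xb cY Yd CXY] := gX n.
have xXn := xX n; have yYn := yY n; have wn := w0 n; have hn := h0 n.
have dist x y : X n <= x <= X n + w n -> Y n <= y <= Y n + h n ->
    `|x - x0| <= r /\ `|y - y0| <= r.
  move=> xI yI; split; rewrite ler_norml; apply/andP; split;
    move: xI yI xXn yYn wh nr wn hn; clear; lra.
have := @circ_small P Q (X n) (X n + w n) (Y n) (Y n + h n) x0 y0 al be ga e
  cP cQ (ltW e0) xXn yYn.
move=> /(_ (fun x y xI yI => let: conj u v := dist x y xI yI in
  Hr x y ltac:(lra) ltac:(lra) u v)).
rewrite !(addrC (X n)) !(addrC (Y n)) !addrK wh => small.
have : eta / 4 ^+ n <= 2 * e * (L / 2 ^+ n) ^+ 2.
  by apply: le_trans small; rewrite (addrC (w n)) (addrC (h n)).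
rewrite expr_div_n -exprM mulnC exprM (_ : 2 ^+ 2 = 4 :> R); last by rewrite expr2; lra.
rewrite mulrA ler_pM2r ?invr_gt0 ?exprn_gt0//.
have : 0 < (L + 1) ^+ 2 by rewrite exprn_gt0//; lra.
move=> L1.
have -> : 2 * e * L ^+ 2 = eta / 2 * (L ^+ 2 / (L + 1) ^+ 2).
  by rewrite /e; field; rewrite lt0r_neq0//; lra.
have : L ^+ 2 / (L + 1) ^+ 2 <= 1 by rewrite ler_pdivrMr// mul1r; nra.
nra.
Qed.

End Goursat.

(** * Removable points and integrals over parallel vertical lines *)

Section ContourShift.
Variable R : realType.
Implicit Types (P Q : R -> R -> R) (a b c d x y e : R).
Local Notation mu := (@lebesgue_measure R).

Lemma closed_at_sub P Q a b c d a' b' c' d' x0 y0 :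
  a <= a' -> b' <= b -> c <= c' -> d' <= d ->
  closed_at P Q a b c d x0 y0 -> closed_at P Q a' b' c' d' x0 y0.
Proof.
move=> aa bb cc dd [al [be [ga H]]]; exists al, be, ga => e /H[r r0 Hr].
by exists r => // x y /andP[? ?] /andP[? ?] xr yr; apply: Hr => //; lra.
Qed.

Lemma segint_itv1 a f : segint a a f = 0 :> R.
Proof. by rewrite /segint set_itv1 Rintegral_set1. Qed.

Lemma circ_degenerate P Q a b c d : a = b \/ c = d -> circ P Q a b c d = 0.
Proof. by rewrite /circ => -[->|->]; rewrite !segint_itv1 !subrr. Qed.

(** The window [[s, t]] around an exceptional abscissa may stick out of [[u, v]] or miss it.
    Clipping it leaves outer pieces [[u, s']] and [[t', v]] that are either degenerate or do not
    enter the interior of the window. *)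
Lemma subinterval_in_window (u v s t : R) : u <= v -> s <= t -> exists s' t' : R,
  [/\ u <= s', s' <= t', t' <= v & t' - s' <= t - s] /\
  (s' = u \/ s' <= s) /\ (t' = v \/ t <= t').
Proof.
move=> uv st; have [vs|sv] := leP v s.
  by exists v, v; split; [split => //; lra|auto].
have [tu|ut] := leP t u.
  by exists u, u; split; [split => //; lra|auto].
exists (Num.max u s), (Num.min v t).
by case: (leP u s) => ?; case: (leP v t) => ?; (split; [split|]); try lra; auto.
Qed.

(** A window of sides at most [2 * e] around [(p, q)] is cut out. The four surrounding rectangles
    avoid the point or are degenerate, so they have circulation 0, and the window contributes at
    most a bound on the form times its perimeter, which is of order [e]. *)
Lemma circ_except P Q a b c d p q : jcont P -> jcont Q -> a <= b -> c <= d ->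
  (forall x0 y0, a <= x0 <= b -> c <= y0 <= d -> (x0, y0) <> (p, q) ->
    closed_at P Q a b c d x0 y0) ->
  circ P Q a b c d = 0.
Proof.
move=> cP cQ ab cd H.
have off a' b' c' d' : a <= a' -> a' <= b' -> b' <= b -> c <= c' -> c' <= d' ->
    d' <= d -> [\/ a' = b', c' = d', b' < p | p < a'] \/ (d' < q \/ q < c') ->
    circ P Q a' b' c' d' = 0.
  move=> aa a'b' bb cc c'd' dd.
  have [?|ne1] := eqVneq a' b'; first by rewrite circ_degenerate; auto.
  have [?|ne2] := eqVneq c' d'; first by rewrite circ_degenerate; auto.
  move=> pq; apply: goursat => // x0 y0 xI yI.
  apply: (@closed_at_sub _ _ a b c d) => //; apply: H; [lra|lra|].
  case=> xp yq; rewrite xp yq in xI yI.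
  case: pq => [[/eqP|/eqP||]|[|]]; rewrite ?(negbTE ne1) ?(negbTE ne2)//; lra.
have [M1 M10 PM] := jcont_bounded a b c d cP.
have [M2 M20 QM] := jcont_bounded a b c d cQ.
have small e : 0 < e -> `|circ P Q a b c d| <= 8 * (M1 + M2) * e.
  move=> e0.
  have [xl [xr [[x1 x2 x3 x6] [x4 x5]]]] :=
    @subinterval_in_window a b (p - e) (p + e) ab ltac:(lra).
  have [yl [yr [[y1 y2 y3 y6] [y4 y5]]]] :=
    @subinterval_in_window c d (q - e) (q + e) cd ltac:(lra).
  rewrite (@circ_splitx R P Q a xl b)//; last lra.
  rewrite (@circ_splitx R P Q xl xr b)//; last lra.
  rewrite (@circ_splity R P Q xl xr c yl d)//; last lra.
  rewrite (@circ_splity R P Q xl xr yl yr d)//; last lra.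
  rewrite (off a xl c d)//; first last.
  - by left; case: x4 => ?; [constructor 1|constructor 3; lra].
  - lra.
  rewrite (off xr b c d)//; first last.
  - by left; case: x5 => ?; [constructor 1|constructor 4; lra].
  - lra.
  rewrite (off xl xr c yl)//; first last.
  - by case: y4 => ?; [left; constructor 2|right; left; lra].
  - lra.
  rewrite (off xl xr yr d)//; first last.
  - by case: y5 => ?; [left; constructor 2|right; right; lra].
  - lra.
  rewrite !(add0r, addr0).
  apply: (@le_trans _ _ (2 * (M1 + M2) * ((xr - xl) + (yr - yl)))).
    apply: circ_bound => // x y ? ?.
      by apply: (@le_trans _ _ M1); [apply: PM; lra|lra].
    by apply: (@le_trans _ _ M2); [apply: QM; lra|lra].
  nra.
apply/eqP; rewrite -normr_le0; apply/ler_addgt0Pr => e e0; rewrite add0r.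
have M0 : 0 < 8 * (M1 + M2) by lra.
apply: le_trans (small (e / (8 * (M1 + M2))) _) _; first by rewrite divr_gt0.
by rewrite mulrC divfK// lt0r_neq0.
Qed.

(** Chebyshev's argument: if [H] stayed above [e] on [A], its integral would be at least [e] times
    an infinite measure. *)
Lemma integral_vanishing_at (H : R -> \bar R) (A : set R) e :
  measurable_fun setT H -> (forall t, 0 <= H t)%E ->
  (\int[mu]_t H t < +oo)%E -> measurable A -> mu A = +oo%E -> 0 < e ->
  exists2 t, A t & (H t <= e%:E)%E.
Proof.
move=> mH H0 Hoo mA Aoo e0; apply: contrapT => N.
have AH t : A t -> (e%:E <= H t)%E.
  move=> At; rewrite leNgt; apply/negP => L; apply: N.
  by exists t => //; exact: ltW.
move: Hoo; apply/negP; rewrite -leNgt.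
apply: (@le_trans _ _ (\int[mu]_(t in A) H t)%E); last first.
  by apply: ge0_subset_integral.
apply: (@le_trans _ _ (\int[mu]_(t in A) e%:E)%E); last first.
  apply: ge0_le_integral => //; first by move=> t _; rewrite lee_fin ltW.
  by apply: measurable_funTS.
by rewrite integral_cst//= Aoo gt0_muley ?lte_fin.
Qed.

Lemma cvg_Rintegral_itv (f : R -> R) (u v : nat -> R) :
  mu.-integrable setT (EFin \o f) ->
  (forall n, u n <= - n%:R) -> (forall n, n%:R <= v n) ->
  \int[mu]_(t in `[u n, v n]) f t @[n --> \oo] --> \int[mu]_t f t.
Proof.
move=> intf un vn.
have mf : measurable_fun setT (EFin \o f) := measurable_int _ intf.
have dc := @dominated_convergence _ _ R mu setT measurableT
   (fun n => (EFin \o f) \_ `[u n, v n]) (EFin \o f) (abse \o (EFin \o f)).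
have [|||||] := dc.
- by move=> n; apply/(measurable_restrictT _ _).1 => //; exact: measurable_funTS.
- exact: mf.
- apply: aeW => x _; apply: cvg_near_cst; near=> n.
  rewrite patchE mem_set//= in_itv/=.
  have xn : `|x| <= n%:R by near: n; exact: nbhs_infty_ger.
  move: xn; rewrite ler_norml => /andP[? ?].
  by have := un n; have := vn n; lra.
- exact: integrable_abse.
- apply: aeW => x n _; rewrite patchE; case: ifP => _ //=.
  by rewrite normr0 lee_fin.
move=> _ _ /= cv.
rewrite /Rintegral; apply: fine_cvg; rewrite fineK; last exact: integrable_fin_num.
by apply: cvg_trans cv; apply: near_eq_cvg; near=> n; rewrite integral_mkcond.
Unshelve. all: end_near. Qed.

(* The circulation around [a, b] x [c, d] vanishes; by Tonelli the horizontal
   sides are integrable in the height, hence small along sequences of heights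
   going to -oo and +oo. *)
Lemma contour_shift P Q a b K : a <= b -> jcont P -> jcont Q ->
  (forall c d, c <= d -> circ P Q a b c d = 0) ->
  (forall x, a <= x <= b -> (\int[mu]_y `|P x y|%:E <= K%:E)%E) ->
  mu.-integrable setT (EFin \o Q a) -> mu.-integrable setT (EFin \o Q b) ->
  \int[mu]_y Q a y = \int[mu]_y Q b y.
Proof.
move=> ab cP cQ circ0 PK iQa iQb.
pose H y : \bar R := (\int[mu]_(x in `[a, b]) `|P x y|%:E)%E.
(* The indicator extends the integrand from the strip to the whole plane, where Tonelli's theorem
   exchanges the integrals. *)
pose f (z : R * R) : \bar R := (`|P z.1 z.2| * \1_(`[a, b]) z.1)%:E.
have f0 z : (0 <= f z)%E by rewrite lee_fin mulr_ge0.
have mf : measurable_fun [set: R * R] f.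
  apply/measurable_EFinP; apply: measurable_funM.
    by apply: measurableT_comp => //; exact: jcont_measurable.
  have mi : measurable_fun [set: R] (\1_`[a, b] : R -> R).
    exact: (measurable_indic (measurable_itv _)).
  exact: (measurableT_comp mi (@measurable_fst _ _ R R)).
have HE : H = fubini_G mu f.
  apply/funext => y; rewrite /H /fubini_G [LHS]integral_mkcond.
  apply: eq_integral => x _; rewrite patchE /f /= indicE.
  by case: ifP => _; rewrite ?mulr1 ?mulr0.
have mH : measurable_fun setT H.
  by rewrite HE; exact: measurable_fun_fubini_tonelli_G.
have H0 y : (0 <= H y)%E by exact: integral_ge0.
have Hoo : (\int[mu]_y H y < +oo)%E.
  have -> : (\int[mu]_y H y = \int[mu]_x \int[mu]_y f (x, y))%E.
    by rewrite HE; exact/esym/fubini_tonelli.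
  have -> : (\int[mu]_x \int[mu]_y f (x, y) =
      \int[mu]_(x in `[a, b]) \int[mu]_y `|P x y|%:E)%E.
    rewrite [RHS]integral_mkcond; apply: eq_integral => x _.
    rewrite patchE /f/= indicE; case: ifP => _.
      by under eq_integral do rewrite mulr1.
    by under eq_integral do rewrite mulr0; rewrite integral0.
  apply: (@le_lt_trans _ _ (\int[mu]_(x in `[a, b]) K%:E)%E).
    apply: ge0_le_integral => //.
    - by move=> x _; exact: integral_ge0.
    - apply: measurable_funTS.
      have mg : measurable_fun [set: R * R] (fun z : R * R => `|P z.1 z.2|%:E).
        apply/measurable_EFinP; apply: measurableT_comp => //.
        exact: jcont_measurable.
      have g0 (z : R * R) : (0 <= `|P z.1 z.2|%:E)%E by rewrite lee_fin.
      have mF : measurable_fun [set: R] (fubini_F mu (fun z : R * R => `|P z.1 z.2|%:E)).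
        exact: measurable_fun_fubini_tonelli_F.
      exact: mF.
  rewrite integral_cst//= lebesgue_measure_itv/= lte_fin.
  by case: ifP => _; rewrite ?mule0 -?EFinB -?EFinM ltry.
have pos n : 0 < n.+1%:R^-1 :> R by rewrite invr_gt0.
have [v vP] : {v : nat -> R &
    forall n, n%:R <= v n /\ (H (v n) <= n.+1%:R^-1%:E)%E}.
  apply: (@choice _ _ (fun n t => n%:R <= t /\ (H t <= n.+1%:R^-1%:E)%E)) => n.
  have [//||t] :=
    @integral_vanishing_at H `[n%:R, +oo[ n.+1%:R^-1 mH H0 Hoo _ _ (pos n).
    by rewrite lebesgue_measure_itv/= ltry.
  by rewrite /= in_itv/= andbT => ? ?; exists t.
have [u uP] : {u : nat -> R &
    forall n, u n <= - n%:R /\ (H (u n) <= n.+1%:R^-1%:E)%E}.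
  apply: (@choice _ _ (fun n t => t <= - n%:R /\ (H t <= n.+1%:R^-1%:E)%E)) => n.
  have [//||t] :=
    @integral_vanishing_at H `]-oo, (- n%:R)] n.+1%:R^-1 mH H0 Hoo _ _ (pos n).
    by rewrite lebesgue_measure_itv/= ltNyr.
  by rewrite /= in_itv/= => ? ?; exists t.
have cPy y : continuous (P ^~ y) := jcont_section (jcont_swap cP) (x := y).
have small y e : (H y <= e%:E)%E -> `|segint a b (P ^~ y)| <= e.
  move=> Hy; rewrite -lee_fin; apply: le_trans Hy.
  rewrite /segint EFin_normr_Rintegral//; last exact: segint_integrable.
  apply: le_abse_integral => //.
  exact: (measurable_int _ (segint_integrable _ _ (cPy y))).
have un n : u n <= - n%:R by have [] := uP n.
have vn n : n%:R <= v n by have [] := vP n.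
have cva := cvg_Rintegral_itv iQa un vn.
have cvb := cvg_Rintegral_itv iQb un vn.
have cvd : \int[mu]_(t in `[u n, v n]) Q b t - \int[mu]_(t in `[u n, v n]) Q a t
    @[n --> \oo] --> (0 : R).
  apply/cvgr0Pnorm_le => e e0; near=> n.
  have ne : n.+1%:R^-1 <= e / 2.
    by apply: ltW; near: n; exact: (near_infty_natSinv_lt (PosNum (divr_gt0 e0 (ltr0n R 2)))).
  have uv : u n <= v n by have := un n; have := vn n; have := ler0n R n; lra.
  (* Since the circulation vanishes, the difference of the vertical sides equals that of the
     horizontal ones, and each of these is at most [e / 2]. *)
  have := circ0 _ _ uv; rewrite /circ /segint => /eqP; rewrite subr_eq0 => /eqP ->.
  have [_ /small] := uP n; have [_ /small] := vP n; rewrite /segint.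
  move=> Hv Hu; apply: (le_trans (ler_normB _ _)).
  by rewrite (splitr e); apply: lerD; [exact: le_trans Hv ne|exact: le_trans Hu ne].
apply/eqP; rewrite eq_sym -subr_eq0; apply/eqP.
exact: (cvg_unique _ (cvgB cvb cva) cvd).
Unshelve. all: end_near. Qed.

End ContourShift.

(** * Complex differentiability *)

Local Notation normc := Normc.normc.
Local Notation Re := complex.Re.
Local Notation Im := complex.Im.

Section ComplexDiff.
Variable R : realType.
Local Notation C := R[i].
Implicit Types (f g F : C -> C) (z w p : C) (a b x y e : R).

Lemma normc_ge0 z : 0 <= normc z.
Proof. by case: z => a b; exact: sqrtr_ge0. Qed.

Lemma normcD z w : normc (z + w) <= normc z + normc w.
Proof. exact: le_normcD. Qed.

Lemma normcN z : normc (- z) = normc z.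
Proof. exact: complex.normcN. Qed.

Lemma normcB z w : normc (z - w) = normc (w - z).
Proof. by rewrite -normcN opprB. Qed.

Lemma normcJ z : normc (conjc z) = normc z.
Proof. by case: z => a b /=; rewrite sqrrN. Qed.

Lemma sqr_normc z : normc z ^+ 2 = Re z ^+ 2 + Im z ^+ 2.
Proof. by case: z => a b /=; rewrite sqr_sqrtr// addr_ge0 ?sqr_ge0. Qed.

Lemma normc_Re z : `|Re z| <= normc z.
Proof.
rewrite -(@ler_pXn2r _ 2)// ?nnegrE ?normr_ge0 ?normc_ge0//.
by rewrite sqr_normc real_normK ?num_real// lerDl sqr_ge0.
Qed.

Lemma normc_Im z : `|Im z| <= normc z.
Proof.
rewrite -(@ler_pXn2r _ 2)// ?nnegrE ?normr_ge0 ?normc_ge0//.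
by rewrite sqr_normc real_normK ?num_real// lerDr sqr_ge0.
Qed.

Lemma normc_le z : normc z <= `|Re z| + `|Im z|.
Proof.
rewrite -(@ler_pXn2r _ 2)// ?nnegrE ?addr_ge0 ?normr_ge0 ?normc_ge0//.
rewrite sqr_normc sqrrD !real_normK ?num_real// lerD2r lerDl.
by rewrite mulrn_wge0// mulr_ge0.
Qed.

Lemma normc_eq0 z : (normc z == 0) = (z == 0).
Proof.
by apply/eqP/eqP => [/Normc.eq0_normc//|->]; exact: Normc.normc0.
Qed.

Lemma normc_gt0 z : (0 < normc z) = (z != 0).
Proof. by rewrite lt0r normc_ge0 andbT normc_eq0. Qed.

Lemma complex_ext z w : Re z = Re w -> Im z = Im w -> z = w.
Proof. by case: z => a b; case: w => c d /= -> ->. Qed.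

Lemma ReB z w : Re (z - w) = Re z - Re w.
Proof. by case: z => a b; case: w. Qed.

Lemma ImB z w : Im (z - w) = Im z - Im w.
Proof. by case: z => a b; case: w. Qed.

Lemma ReD z w : Re (z + w) = Re z + Re w.
Proof. by case: z => a b; case: w. Qed.

Lemma ImD z w : Im (z + w) = Im z + Im w.
Proof. by case: z => a b; case: w. Qed.

Lemma conjcD z w : conjc (z + w) = conjc z + conjc w.
Proof. by case: z => a b; case: w => c d /=; rewrite opprD. Qed.

Lemma conjcN z : conjc (- z) = - conjc z.
Proof. by case: z. Qed.

Lemma conjcB z w : conjc (z - w) = conjc z - conjc w.
Proof. by rewrite conjcD conjcN. Qed.

Lemma conjcM z w : conjc (z * w) = conjc z * conjc w.
Proof.
case: z => a b; case: w => c d /=; apply/eqP; rewrite eq_complex/=.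
by rewrite !mulrN !mulNr opprK opprD !eqxx.
Qed.

Definition ccont F z := forall e, 0 < e -> exists2 r, 0 < r &
  forall w, normc (w - z) <= r -> normc (F w - F z) <= e.

Definition cdiff_at F z d := forall e, 0 < e -> exists2 r, 0 < r &
  forall w, normc (w - z) <= r ->
    normc (F w - F z - d * (w - z)) <= e * normc (w - z).

(** In [C^o] the norm and the epsilons are themselves complex numbers, positivity meaning real and
    positive; this equivalence brings all estimates down to the real-valued [normc], where linear
    arithmetic applies. *)
Lemma derivable_cdiff F z :
  derivable (F : C^o -> C^o) z 1 <-> exists d, cdiff_at F z d.
Proof.
have nE (x : C) : `|x| = (normc x)%:C%C by [].
split=> [/cvg_ex[d /cvgrPdist_le H]|[d H]].
  exists d => e e0.
  have := H e%:C%C; rewrite ltcR => /(_ e0); rewrite nearE => -[r /= r0 Hr].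
  have rE : r = (Re r)%:C%C by rewrite RRe_real// gtr0_real.
  have Re0 : 0 < Re r by rewrite -ltcR -rE.
  exists (Re r / 2) => [|w wz]; first by rewrite divr_gt0.
  have [->|wzn] := eqVneq w z; first by rewrite !subrr mulr0 subr0 Normc.normc0 mulr0.
  have h0 : w - z != 0 by rewrite subr_eq0.
  have wr : normc (w - z) < Re r by apply: le_lt_trans wz _; lra.
  have := Hr (w - z); rewrite /= sub0r normrN nE rE ltcR => /(_ wr h0).
  rewrite (_ : (w - z)%:A + z = w); last by rewrite /GRing.scale/= mulr1 subrK.
  rewrite nE lecR => K.
  have -> : F w - F z - d * (w - z) = (w - z) * - (d - (w - z)^-1 * (F w - F z)).
    by field.
  rewrite Normc.normcM normcN mulrC ler_wpM2r// normc_ge0.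
by [].
apply/cvg_ex; exists d; apply/cvgrPdist_le => e e0.
have eE : e = (Re e)%:C%C by rewrite RRe_real// gtr0_real.
have Re0 : 0 < Re e by rewrite -ltcR -eE.
have [r r0 Hr] := H _ Re0.
rewrite nearE; exists r%:C%C; first by rewrite /= ltcR.
move=> h /=; rewrite sub0r normrN nE ltcR => hr h0.
have := Hr (h + z); rewrite addrK => /(_ (ltW hr)) K.
rewrite (_ : h%:A = h); last by rewrite /GRing.scale/= mulr1.
rewrite nE eE lecR.
have -> : d - h^-1 *: (F (h + z) - F z) = - h^-1 * (F (h + z) - F z - d * h).
  by rewrite /GRing.scale/=; field.
rewrite Normc.normcM normcN Normc.normcV mulrC ler_pdivrMr ?normc_gt0//.
Qed.

Lemma cdiff_cont F z d : cdiff_at F z d -> ccont F z.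
Proof.
move=> H e e0; have [r r0 Hr] := H 1 ltr01.
have d0 := normc_ge0 d.
exists (Num.min r (e / (1 + normc d))).
  by rewrite lt_min r0 divr_gt0//; lra.
move=> w; rewrite le_min => /andP[/Hr + we].
rewrite ler_pdivlMr in we; last lra.
have := normcD (F w - F z - d * (w - z)) (d * (w - z)).
by rewrite subrK Normc.normcM; nra.
Qed.

Lemma cdiff_reflect F z d (c : C) : cdiff_at F (c - conjc z) d ->
  cdiff_at (fun z => conjc (F (c - conjc z))) z (- conjc d).
Proof.
move=> H e /H[r r0 Hr]; exists r => // w wz.
have E : (c - conjc w) - (c - conjc z) = - conjc (w - z).
  by rewrite conjcB; ring.
have := Hr (c - conjc w); rewrite E normcN normcJ => /(_ wz).
rewrite -normcJ; congr (normc _ <= _).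
by rewrite !(conjcB, conjcM, conjcN) !conjcK; ring.
Qed.

Lemma cdiff_shift F z c d : cdiff_at F (z + c) d ->
  cdiff_at (fun z => F (z + c)) z d.
Proof.
move=> H e /H[r r0 Hr]; exists r => // w wz.
have E : w + c - (z + c) = w - z by rewrite opprD addrACA subrr addr0.
by have := Hr (w + c); rewrite E => /(_ wz).
Qed.

Lemma cdiffD F G z d d' : cdiff_at F z d -> cdiff_at G z d' ->
  cdiff_at (fun z => F z + G z) z (d + d').
Proof.
move=> H H' e e0; have e2 : 0 < e / 2 by rewrite divr_gt0.
have [r r0 Hr] := H _ e2; have [s s0 Hs] := H' _ e2.
exists (Num.min r s); first by rewrite lt_min r0.
move=> w; rewrite le_min => /andP[/Hr + /Hs].
rewrite (_ : F w + G w - _ - _ =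
  (F w - F z - d * (w - z)) + (G w - G z - d' * (w - z))); last ring.
have := normcD (F w - F z - d * (w - z)) (G w - G z - d' * (w - z)).
lra.
Qed.

Lemma cdiffM F G z d d' : cdiff_at F z d -> cdiff_at G z d' ->
  cdiff_at (fun z => F z * G z) z (d * G z + F z * d').
Proof.
move=> H H' e e0.
have A0 := normc_ge0 (F z); have B0 := normc_ge0 (G z); have D0 := normc_ge0 d.
(* [k] dominates the sum of the coefficients of [q * n] in [i1], [i2] and [i3] below, with
   [q = e / k]. *)
pose k := 2 + normc (F z) + normc (G z) + normc d.
have k0 : 0 < k by rewrite /k; lra.
have e1 : 0 < e / k by rewrite divr_gt0.
have [r r0 Hr] := H _ e1; have [s s0 Hs] := H' _ e1.
have [t t0 Ht] := cdiff_cont H' e1.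
have [u u0 Hu] := cdiff_cont H' ltr01.
exists (Num.min (Num.min r s) (Num.min t u)); first by rewrite !lt_min r0 s0 t0.
move=> w; rewrite !le_min => /andP[/andP[/Hr h1 /Hs h2] /andP[/Ht h3 /Hu h4]].
rewrite (_ : F w * G w - F z * G z - _ =
   (F w - F z - d * (w - z)) * (G z + (G w - G z)) +
   F z * (G w - G z - d' * (w - z)) + d * (w - z) * (G w - G z)); last ring.
set x1 := F w - F z - _ in h1 *; set x2 := G w - G z - _ in h2 *.
set x3 := G w - G z in h3 h4 *.
apply: le_trans (normcD _ _) _.
apply: le_trans (lerD (normcD _ _) (lexx _)) _.
rewrite !Normc.normcM.
have h5 := normcD (G z) x3.
set n := normc (w - z) in h1 h2 *.
have n0 : 0 <= n by exact: normc_ge0.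
set q := e / k in e1 h1 h2 h3.
have -> : e = q * k by rewrite /q divfK// lt0r_neq0.
have i1 : normc x1 * normc (G z + x3) <= (q * n) * (normc (G z) + 1).
  by apply: ler_pM => //; rewrite ?normc_ge0//; lra.
have i2 : normc (F z) * normc x2 <= normc (F z) * (q * n) by exact: ler_wpM2l.
have i3 : normc d * n * normc x3 <= normc d * n * q.
  by apply: ler_wpM2l => //; exact: mulr_ge0.
have qn : 0 <= q * n by apply: mulr_ge0 => //; exact: ltW.
rewrite /k; lra.
Qed.

Lemma cdiff_cst (c : C) z : cdiff_at (fun=> c) z 0.
Proof.
move=> e e0; exists 1 => // w _.
by rewrite subrr mul0r subrr Normc.normc0 mulr_ge0 ?normc_ge0 ?ltW.
Qed.

Lemma cdiffV z : z != 0 -> exists d, cdiff_at (fun z => z^-1) z d.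
Proof.
move=> z0; apply/derivable_cdiff.
by apply: (@derivableV C C^o (fun z => z)) => //; exact: derivable_id.
Qed.

End ComplexDiff.

(** * Cauchy's theorem on a vertical strip *)

Section ComplexContour.
Variable R : realType.
Local Notation C := R[i].
Local Notation mu := (@lebesgue_measure R).
Implicit Types (f g F : C -> C) (z w p : C) (a b x y e : R) (phi : C -> R).

(** Freezing the abscissa outside [[a, b]] makes a function that is continuous only on the strip
    [jcont] on the whole plane, without changing it on the strip. *)
Definition clamp a b x : R := Num.max a (Num.min b x).

Lemma clamp_itv a b x : a <= b -> a <= clamp a b x <= b.
Proof.
move=> ab; rewrite /clamp.
by case: (leP b x) => ?; [case: (leP a b)|case: (leP a x)] => ?; lra.
Qed.

Lemma clamp_id a b x : a <= x <= b -> clamp a b x = x.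
Proof.
by rewrite /clamp => /andP[ax xb]; rewrite min_r// max_r.
Qed.

Lemma clamp_contract a b x x' : a <= b -> `|clamp a b x' - clamp a b x| <= `|x' - x|.
Proof.
move=> ab; have := ler_norm (x' - x); have := ler_norm (x - x'); rewrite (distrC x) => H1 H2.
rewrite ler_norml /clamp.
by case: (leP b x) => ?; case: (leP b x') => ?; try (case: (leP a x) => ?);
  try (case: (leP a x') => ?); try (case: (leP a b) => ?); apply/andP; split; lra.
Qed.

Lemma Re_contract z w : `|Re z - Re w| <= normc (z - w).
Proof. by rewrite -ReB; exact: normc_Re. Qed.

Lemma Im_contract z w : `|Im z - Im w| <= normc (z - w).
Proof. by rewrite -ImB; exact: normc_Im. Qed.

Lemma normc_contract z w : `|normc z - normc w| <= normc (z - w).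
Proof.
have := normcD (z - w) w; have := normcD (w - z) z; rewrite !subrK (normcB w).
by move=> ? ?; rewrite ler_norml; apply/andP; split; lra.
Qed.

(** [phi] stands for [Re], [Im] or [normc], which are all 1-Lipschitz; one statement serves the
    three. *)
Lemma jcont_strip phi F a b : (forall z w, `|phi z - phi w| <= normc (z - w)) ->
  a <= b -> (forall z, a <= Re z <= b -> ccont F z) ->
  jcont (fun x y => phi (F (Complex (clamp a b x) y))).
Proof.
move=> phiC ab cF x y e e0.
have [r r0 Hr] := cF (Complex (clamp a b x) y) (clamp_itv _ ab) e e0.
exists (r / 2) => [|x' y' xx yy]; first by rewrite divr_gt0.
apply: le_trans (phiC _ _) _; apply: Hr.
apply: le_trans (normc_le _) _; rewrite ReB ImB/=.
have := clamp_contract x x' ab; lra.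
Qed.

Lemma continuous_line phi F x : (forall z w, `|phi z - phi w| <= normc (z - w)) ->
  (forall y, ccont F (Complex x y)) ->
  continuous (fun y => phi (F (Complex x y))).
Proof.
move=> phiC cF.
have cF' z : x <= Re z <= x -> ccont F z.
  by case: z => a b /=; rewrite -eq_le => /eqP <-.
have := @jcont_section R _ x (jcont_strip phiC (lexx x) cF').
by rewrite clamp_id ?lexx.
Qed.

Lemma integrable_line phi F x K : (forall z w, `|phi z - phi w| <= normc (z - w)) ->
  (forall z, `|phi z| <= normc z) -> (forall y, ccont F (Complex x y)) ->
  (\int[mu]_y (normc (F (Complex x y)))%:E <= K%:E)%E ->
  mu.-integrable setT (EFin \o (fun y => phi (F (Complex x y)))).
Proof.
move=> phiC phi_le cF FK; apply/integrableP; split.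
  by apply/measurable_EFinP; apply: continuous_measurable_fun; exact: (continuous_line phiC cF).
apply: le_lt_trans (le_lt_trans FK (ltry K)).
apply: ge0_le_integral => //.
- by apply/measurable_EFinP; apply: measurableT_comp => //;
    apply: continuous_measurable_fun; exact: (continuous_line phiC cF).
- apply/measurable_EFinP; apply: continuous_measurable_fun.
  by apply: continuous_line => // z w; exact: normc_contract.
- by move=> y _ /=; rewrite lee_fin.
Qed.

(** These are the Cauchy-Riemann equations: multiplication by [k] has [Re k] as the coefficient both
    of [y] in the imaginary part and of [x] in the real part, which is the mixed coefficient that
    [closed_at] requires to agree. *)
Lemma closed_at_cdiff F a b c d x0 y0 k : a <= x0 <= b ->
  cdiff_at F (Complex x0 y0) k ->
  closed_at (fun x y => Im (F (Complex (clamp a b x) y)))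
            (fun x y => Re (F (Complex (clamp a b x) y))) a b c d x0 y0.
Proof.
move=> x0ab H; exists (Im k), (Re k), (- Im k) => e e0.
have [r r0 Hr] := H e e0.
exists (r / 2) => [|x y xab ycd xr yr]; first by rewrite divr_gt0.
rewrite !clamp_id//.
set w := Complex x y; set z := Complex x0 y0.
have wz : normc (w - z) <= `|x - x0| + `|y - y0|.
  by apply: le_trans (normc_le _) _; rewrite ReB ImB.
have wr : normc (w - z) <= r by lra.
have B : normc (F w - F z - k * (w - z)) <= e * (`|x - x0| + `|y - y0|).
  by apply: le_trans (Hr w wr) _; rewrite ler_pM2l.
have kE : k * (w - z) = Complex (Re k * (x - x0) - Im k * (y - y0))
    (Im k * (x - x0) + Re k * (y - y0)).
  by case: k {H Hr B} => k1 k2; apply/eqP; rewrite eq_complex/=;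
    apply/andP; split; apply/eqP; ring.
split; apply: le_trans B.
- by apply: le_trans (normc_Im _); rewrite !ImB kE.
- apply: le_trans (normc_Re _); rewrite !ReB kE/=.
  by rewrite le_eqVlt; apply/orP; left; apply/eqP; congr `| _ |; ring.
Qed.

(* Cauchy's theorem on a vertical strip, with one removable exceptional point. *)
Lemma Re_integral_line_eq F a b p K : a <= b ->
  (forall z, a <= Re z <= b -> ccont F z) ->
  (forall z, a <= Re z <= b -> z <> p -> exists d, cdiff_at F z d) ->
  (forall x, a <= x <= b ->
    (\int[mu]_y (normc (F (Complex x y)))%:E <= K%:E)%E) ->
  \int[mu]_y Re (F (Complex a y)) = \int[mu]_y Re (F (Complex b y)).
Proof.
move=> ab cF dF FK.
pose P x y := Im (F (Complex (clamp a b x) y)).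
pose Q x y := Re (F (Complex (clamp a b x) y)).
have cP : jcont P := jcont_strip Im_contract ab cF.
have cQ : jcont Q := jcont_strip Re_contract ab cF.
have aI : a <= a <= b by rewrite lexx.
have bI : a <= b <= b by rewrite lexx andbT.
have cl x : a <= x <= b -> forall y, ccont F (Complex x y) by move=> xI y; exact: cF.
have QE x : a <= x <= b -> Q x = fun y => Re (F (Complex x y)).
  by move=> xI; apply/funext => y; rewrite /Q clamp_id.
have iQ x : a <= x <= b -> mu.-integrable setT (EFin \o Q x).
  move=> xI; rewrite QE//; apply: (@integrable_line _ _ _ K) => //.
  - exact: Re_contract.
  - exact: normc_Re.
  - exact: cl.
  - exact: FK.
have := @contour_shift R P Q a b K ab cP cQ _ _ (iQ a aI) (iQ b bI).
rewrite (QE a aI) (QE b bI); apply.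
- move=> c d cd; apply: (@circ_except R P Q a b c d (Re p) (Im p)) => //.
  move=> x0 y0 x0I y0I ne.
  have [|k Hk] := dF (Complex x0 y0) x0I.
    by move=> E; apply: ne; rewrite -E.
  exact: closed_at_cdiff Hk.
- move=> x xI; apply: le_trans (FK x xI).
  apply: ge0_le_integral => //.
  + apply/measurable_EFinP; apply: measurableT_comp => //.
    by apply: continuous_measurable_fun; exact: jcont_section.
  + apply/measurable_EFinP; apply: continuous_measurable_fun.
    by apply: continuous_line; [exact: normc_contract|exact: cl].
  + by move=> y _; rewrite lee_fin /P clamp_id//; exact: normc_Im.
Qed.

End ComplexContour.

(** * Square-integrable functions on a vertical line *)

Section L2Line.
Variable R : realType.
Local Notation C := R[i].
Local Notation mu := (@lebesgue_measure R).
Implicit Types (u v : R -> C).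

Lemma Re_mulJ (z w : C) : Re (z * conjc w) = Re z * Re w + Im z * Im w.
Proof. by case: z => a b; case: w => c d /=; rewrite mulrN opprK. Qed.

Definition L2 u := [/\ measurable_fun [set: R] (fun y => Re (u y)),
  measurable_fun [set: R] (fun y => Im (u y)) &
  (\int[mu]_y (normc (u y) ^+ 2)%:E < +oo)%E].

Definition nsq u := \int[mu]_y (normc (u y) ^+ 2).

(** Keeping the real part alone makes every integral real-valued; the imaginary part of the
    Hermitian pairing of [u] and [v] is [dotRe] of [u] and [i * v]. *)
Definition dotRe u v := \int[mu]_y Re (u y * conjc (v y)).

Lemma L2_measurable_sq u : L2 u ->
  measurable_fun [set: R] (fun y => normc (u y) ^+ 2).
Proof.
case=> mR mI _; under eq_fun do rewrite sqr_normc.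
by apply: measurable_funD; exact: measurable_funX.
Qed.

Lemma L2_integrable_sq u : L2 u ->
  mu.-integrable setT (EFin \o (fun y => normc (u y) ^+ 2)).
Proof.
move=> Lu; apply/integrableP; split.
  by apply/measurable_EFinP; exact: L2_measurable_sq.
under eq_integral do rewrite /= ger0_norm ?sqr_ge0//.
by case: Lu.
Qed.

Lemma L2_nsqE u : L2 u -> (\int[mu]_y (normc (u y) ^+ 2)%:E = (nsq u)%:E)%E.
Proof.
move=> Lu; rewrite /nsq /Rintegral fineK//.
exact: (integrable_fin_num measurableT (L2_integrable_sq Lu)).
Qed.

Lemma nsq_ge0 u : 0 <= nsq u.
Proof. by apply: Rintegral_ge0 => y _; exact: sqr_ge0. Qed.

Lemma young (a b t : R) : 0 < t -> a * b <= (t * a ^+ 2 + b ^+ 2 / t) / 2.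
Proof.
move=> t0; rewrite -subr_ge0.
have -> : (t * a ^+ 2 + b ^+ 2 / t) / 2 - a * b = (t * a - b) ^+ 2 / (2 * t).
  by field; rewrite lt0r_neq0.
by rewrite divr_ge0 ?sqr_ge0// mulr_ge0// ltW.
Qed.

Lemma L2_measurable_norm u : L2 u -> measurable_fun [set: R] (fun y => normc (u y)).
Proof.
move=> Lu; have -> : (fun y => normc (u y)) = Num.sqrt \o (fun y => normc (u y) ^+ 2).
  by apply/funext => y /=; rewrite sqrtr_sqr ger0_norm// normc_ge0.
apply: measurableT_comp; last exact: L2_measurable_sq.
by apply: continuous_measurable_fun; exact: sqrt_continuous.
Qed.

(** The weighted arithmetic-geometric mean inequality plays the part of Cauchy-Schwarz. [t = 1]
    suffices for integrability; in [kern_orth] the weight is tuned so that a small second norm beats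
    a bounded first one. *)
Lemma L2_young u v t : L2 u -> L2 v -> 0 < t ->
  (\int[mu]_y (normc (u y) * normc (v y))%:E <= ((t * nsq u + nsq v / t) / 2)%:E)%E.
Proof.
move=> Lu Lv t0.
have iu := L2_integrable_sq Lu; have iv := L2_integrable_sq Lv.
have -> : ((t * nsq u + nsq v / t) / 2)%:E =
  (\int[mu]_y ((t / 2 * normc (u y) ^+ 2 + (2 * t)^-1 * normc (v y) ^+ 2)%:E))%E.
  rewrite (_ : (t * nsq u + nsq v / t) / 2 = t / 2 * nsq u + (2 * t)^-1 * nsq v); last first.
    by field; rewrite lt0r_neq0.
  rewrite EFinD !EFinM -!L2_nsqE// -!integralZl//.
  by rewrite -integralD//; [exact: integrableZl|exact: integrableZl].
apply: ge0_le_integral => //.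
- by move=> y _; rewrite lee_fin mulr_ge0// normc_ge0.
- by apply/measurable_EFinP; apply: measurable_funM; exact: L2_measurable_norm.
- apply/measurable_EFinP; apply: measurable_funD; apply: measurable_funM => //;
  exact: L2_measurable_sq.
- move=> y _; rewrite lee_fin; apply: le_trans (young _ _ t0) _.
  by rewrite le_eqVlt; apply/orP; left; apply/eqP; field; rewrite lt0r_neq0.
Qed.

Lemma L2_measurable_dot u v : L2 u -> L2 v ->
  measurable_fun [set: R] (fun y => Re (u y * conjc (v y))).
Proof.
move=> [mRu mIu _] [mRv mIv _]; under eq_fun do rewrite Re_mulJ.
by apply: measurable_funD; exact: measurable_funM.
Qed.

Lemma L2_integrable_dot u v : L2 u -> L2 v ->
  mu.-integrable setT (EFin \o (fun y => Re (u y * conjc (v y)))).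
Proof.
move=> Lu Lv; apply/integrableP; split.
  by apply/measurable_EFinP; exact: L2_measurable_dot.
apply: le_lt_trans (ltry ((1 * nsq u + nsq v / 1) / 2)).
apply: le_trans (L2_young Lu Lv ltr01).
apply: ge0_le_integral => //.
- by apply/measurable_EFinP; apply: measurableT_comp => //; exact: L2_measurable_dot.
- by apply/measurable_EFinP; apply: measurable_funM; exact: L2_measurable_norm.
- move=> y _ /=; rewrite lee_fin; apply: le_trans (normc_Re _) _.
  by rewrite Normc.normcM normcJ.
Qed.

Lemma sqr_normcD (z w : C) :
  normc (z + w) ^+ 2 = normc z ^+ 2 + normc w ^+ 2 + 2 * Re (z * conjc w).
Proof. by rewrite !sqr_normc ReD ImD Re_mulJ; ring. Qed.

Lemma L2D u v : L2 u -> L2 v -> L2 (fun y => u y + v y).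
Proof.
move=> Lu Lv; have [mRu mIu _] := Lu; have [mRv mIv _] := Lv; split.
- by under eq_fun do rewrite ReD; exact: measurable_funD.
- by under eq_fun do rewrite ImD; exact: measurable_funD.
have iu := L2_integrable_sq Lu; have iv := L2_integrable_sq Lv.
have iw := integrableZl measurableT 2 (L2_integrable_dot Lu Lv).
have /integrableP[_] := integrableD measurableT (integrableD measurableT iu iv) iw.
apply: le_lt_trans; rewrite le_eqVlt; apply/orP; left; apply/eqP.
apply: eq_integral => y _.
rewrite [RHS](_ : _ = `|(normc (u y) ^+ 2 + normc (v y) ^+ 2 +
  2 * Re (u y * conjc (v y)))%:E|%E)// -sqr_normcD.
by rewrite /= ger0_norm// sqr_ge0.
Qed.

Lemma L2Z (c : C) u : L2 u -> L2 (fun y => c * u y).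
Proof.
move=> Lu; have [mRu mIu _] := Lu; split.
- rewrite (_ : (fun y => _) = (fun y => Re c * Re (u y) - Im c * Im (u y))).
    by apply: measurable_funB; apply: measurable_funM.
  by apply/funext => y; case: c => a b; case: (u y).
- rewrite (_ : (fun y => _) = (fun y => Re c * Im (u y) + Im c * Re (u y))).
    by apply: measurable_funD; apply: measurable_funM.
  by apply/funext => y; case: c => a b; case: (u y).
under eq_integral do rewrite Normc.normcM exprMn EFinM.
by rewrite integralZl// ?L2_nsqE ?ltry//; exact: L2_integrable_sq.
Qed.

Lemma nsqZ (c : C) u : L2 u -> nsq (fun y => c * u y) = normc c ^+ 2 * nsq u.
Proof.
move=> Lu; rewrite /nsq -RintegralZl//; last exact: L2_integrable_sq.
by apply: eq_Rintegral => y _; rewrite Normc.normcM exprMn.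
Qed.

Lemma nsqD u v : L2 u -> L2 v ->
  nsq (fun y => u y + v y) = nsq u + nsq v + 2 * dotRe u v.
Proof.
move=> Lu Lv.
have iu := L2_integrable_sq Lu; have iv := L2_integrable_sq Lv.
have iw := L2_integrable_dot Lu Lv.
rewrite /nsq /dotRe -RintegralZl// -!RintegralD//.
- by apply: eq_Rintegral => y _; exact: sqr_normcD.
- exact: (integrableD measurableT iu iv).
- exact: (integrableZl measurableT _ iw).
Qed.

Lemma nsqB u v : L2 u -> L2 v ->
  nsq (fun y => u y - v y) = nsq u + nsq v - 2 * dotRe u v.
Proof.
move=> Lu Lv.
have iu := L2_integrable_sq Lu; have iv := L2_integrable_sq Lv.
have iw := L2_integrable_dot Lu Lv.
rewrite /nsq /dotRe -RintegralZl// -RintegralD// -RintegralB//.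
- apply: eq_Rintegral => y _; rewrite sqr_normcD normcN.
  by rewrite !Re_mulJ; case: (v y) => a b /=; ring.
- exact: (integrableD measurableT iu iv).
- exact: (integrableZl measurableT _ iw).
Qed.

Lemma dotRe_polar u v : L2 u -> L2 v ->
  dotRe u v = (nsq (fun y => u y + v y) - nsq (fun y => u y - v y)) / 4.
Proof. by move=> Lu Lv; rewrite nsqD// nsqB//; field. Qed.

Lemma dotRexx u : dotRe u u = nsq u.
Proof.
by apply: eq_Rintegral => y _; rewrite Re_mulJ sqr_normc !expr2.
Qed.

Lemma dotReC u v : dotRe u v = dotRe v u.
Proof.
by apply: eq_Rintegral => y _; rewrite !Re_mulJ mulrC [_ * Im _]mulrC.
Qed.

Lemma integral_translate (G : R -> R) c : continuous G -> (forall y, 0 <= G y) ->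
  (\int[mu]_y (G (y + c))%:E = \int[mu]_y (G y)%:E)%E.
Proof.
move=> cG G0; pose F y : R := y + c.
have dF (y : R) : is_derive y (1 : R) F 1 by exact: is_derive_shift.
have F' : (F^`())%classic = cst 1 by apply/funext => y; rewrite derive1E; exact: derive_val.
rewrite [RHS](@increasing_ge0_integration_by_substitutionT _ F)//.
- by apply: eq_integral => y _ /=; rewrite F'/= mulr1.
- by move=> x y xy; rewrite /F ltrD2r.
- by rewrite F'; exact: cst_continuous.
- by rewrite F'; exact: is_cvg_cst.
- by rewrite F'; exact: is_cvg_cst.
- apply/cvgrNyPle => M; near=> y; rewrite /F -lerBrDr; near: y;
  by apply: nbhs_ninfty_le; exact: num_real.
- apply/cvgryPge => M; near=> y; rewrite /F -lerBlDr; near: y;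
  by apply: nbhs_pinfty_ge; exact: num_real.
Unshelve. all: end_near. Qed.

End L2Line.

(** * Boundary values in the Hardy space *)

Section Hardy.
Variable R : realType.
Local Notation C := R[i].
Local Notation mu := (@lebesgue_measure R).
Implicit Types (f g : C -> C) (z w b c : C) (x y s e : R).

Definition line f x : R -> C := fun y => f (Complex x y).

Lemma H2_cdiff f z : H2 f -> 0 < Re z -> exists d, cdiff_at f z d.
Proof. by move=> [af _] z0; apply/derivable_cdiff; exact: af. Qed.

Lemma H2_cont f z : H2 f -> 0 < Re z -> ccont f z.
Proof. by move=> Hf /(H2_cdiff Hf)[d]; exact: cdiff_cont. Qed.

Lemma analytic_L2 f x K : (forall z, 0 < Re z -> ccont f z) -> 0 < x ->
  (\int[mu]_y (normc (f (Complex x y)) ^+ 2)%:E <= K%:E)%E -> L2 (line f x).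
Proof.
move=> cf x0 fK; split; last exact: le_lt_trans fK (ltry K).
- apply: continuous_measurable_fun; apply: continuous_line; first exact: Re_contract.
  by move=> y; exact: cf.
- apply: continuous_measurable_fun; apply: continuous_line; first exact: Im_contract.
  by move=> y; exact: cf.
Qed.

Lemma hardy_norm2_ge f x : 0 < x ->
  (\int[mu]_y (normc (f (Complex x y)) ^+ 2)%:E <= pi%:E * hardy_norm2 f)%E.
Proof.
move=> x0; rewrite -lee_pdivrMl ?pi_gt0//.
by apply: ereal_sup_ubound; exists x.
Qed.

Lemma hardy_norm2_ge0 f : (0 <= hardy_norm2 f)%E.
Proof.
apply: (@le_trans _ _ (pi^-1%:E *
    \int[mu]_y (normc (f (Complex 1 y)) ^+ 2)%:E)%E); last first.
  by apply: ereal_sup_ubound; exists 1 => //; exact: ltr01.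
by rewrite mule_ge0// ?lee_fin ?invr_ge0 ?pi_ge0//;
  apply: integral_ge0 => y _; rewrite lee_fin sqr_ge0.
Qed.

Lemma H2normE f : H2 f -> (hardy_norm2 f = (H2norm f ^+ 2)%:E)%E.
Proof.
move=> [_ f_fin]; have f0 := hardy_norm2_ge0 f.
by rewrite /H2norm sqr_sqrtr ?fine_ge0// fineK// ge0_fin_numE.
Qed.

Lemma H2_sqint f x : H2 f -> 0 < x ->
  (\int[mu]_y (normc (f (Complex x y)) ^+ 2)%:E <= (pi * H2norm f ^+ 2)%:E)%E.
Proof. by move=> Hf x0; rewrite EFinM -H2normE//; exact: hardy_norm2_ge. Qed.

Lemma H2_L2 f x : H2 f -> 0 < x -> L2 (line f x).
Proof.
move=> Hf x0; apply: analytic_L2 (H2_sqint Hf x0) => //.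
by move=> z; exact: H2_cont.
Qed.

Lemma H2_nsq_le f x : H2 f -> 0 < x -> nsq (line f x) <= pi * H2norm f ^+ 2.
Proof.
move=> Hf x0; rewrite -lee_fin -L2_nsqE; last exact: H2_L2.
exact: H2_sqint.
Qed.

Lemma H2_intro f K : (forall z, 0 < Re z -> exists d, cdiff_at f z d) ->
  (forall x, 0 < x ->
    (\int[mu]_y (normc (f (Complex x y)) ^+ 2)%:E <= K%:E)%E) -> H2 f.
Proof.
move=> df fK; split; first by move=> z z0; apply/derivable_cdiff; exact: df.
apply: (@le_lt_trans _ _ (pi^-1 * K)%:E); last exact: ltry.
apply: ge_ereal_sup => _ [x x0 <-]; rewrite EFinM.
by apply: lee_pmul => //; rewrite ?lee_fin ?invr_ge0 ?pi_ge0//;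
  [apply: integral_ge0 => y _; rewrite lee_fin sqr_ge0|exact: fK].
Qed.

Lemma H2_comb f g c : H2 f -> H2 g -> H2 (fun z => f z + c * g z).
Proof.
move=> Hf Hg.
(* The parallelogram law on each line: the squared norm of a sum is at most twice the sum of the
   squared norms. *)
pose K := 2 * (pi * H2norm f ^+ 2) + 2 * (normc c ^+ 2 * (pi * H2norm g ^+ 2)).
apply: (@H2_intro _ K) => [z z0|x x0].
  have [d Hd] := H2_cdiff Hf z0; have [d' Hd'] := H2_cdiff Hg z0.
  exists (d + (0 * g z + c * d')); apply: cdiffD => //.
  by apply: cdiffM => //; exact: cdiff_cst.
have Lf := H2_L2 Hf x0; have Lg := H2_L2 Hg x0; have Lcg := L2Z c Lg.
have := L2_nsqE (L2D Lf Lcg); rewrite /line => ->; rewrite lee_fin.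
have E1 := nsqD Lf Lcg; have E2 := nsqB Lf Lcg.
have := nsq_ge0 (fun y => line f x y - c * line g x y).
change (0 <= nsq (fun y => line f x y - c * line g x y) ->
  nsq (fun y => line f x y + c * line g x y) <= K).
rewrite E1 E2 nsqZ//.
have := H2_nsq_le Hf x0; have := H2_nsq_le Hg x0; have := sqr_ge0 (normc c).
rewrite /K; nra.
Qed.

Lemma H2Z f c : H2 f -> H2 (fun z => c * f z).
Proof.
move=> Hf; have := H2_comb (c - 1) Hf Hf; congr H2.
by apply/funext => z; ring.
Qed.

(* The integrand is the restriction to a vertical line of the function
   F below, which is analytic in z because conjugation is applied twice. *)
Lemma dotRe_shift f g x x' s : H2 f -> H2 g -> 0 < x -> 0 <= s -> s < x' ->
  dotRe (line f x) (line g x') = dotRe (line f (x + s)) (line g (x' - s)).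
Proof.
move=> Hf Hg x0 s0 sx'.
pose F z := f z * conjc (g (Complex (x + x') 0 - conjc z)).
have FE t y : F (Complex t y) = f (Complex t y) * conjc (g (Complex (x + x' - t) y)).
  by rewrite /F; congr (_ * conjc (g _)); apply/eqP; rewrite eq_complex/= sub0r opprK !eqxx.
pose K := (pi * H2norm f ^+ 2 + pi * H2norm g ^+ 2) / 2.
(* While [Re z] runs from [x] to [x + s], the line on which [g] is evaluated runs from [x'] down to
   [x' - s], which is still positive. *)
have dF z : x <= Re z <= x + s -> exists d, cdiff_at F z d.
  move=> zI; have [d Hd] := @H2_cdiff f z Hf ltac:(lra).
  have [|d' Hd'] := @H2_cdiff g (Complex (x + x') 0 - conjc z) Hg.
    by case: z zI {Hd} => a b /=; lra.
  by eexists; apply: (cdiffM Hd); exact: cdiff_reflect Hd'.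
have := @Re_integral_line_eq R F x (x + s) 0 K ltac:(lra) _ _ _.
have FI t : \int[mu]_y Re (F (Complex t y)) = dotRe (line f t) (line g (x + x' - t)).
  by apply: eq_Rintegral => y _; rewrite FE.
rewrite !FI (_ : x + x' - x = x'); last by ring.
rewrite (_ : x + x' - (x + s) = x' - s); last by ring.
apply.
- by move=> z /dF[d]; exact: cdiff_cont.
- by move=> z /dF.
- move=> t tI.
  have Lf := @H2_L2 f t Hf ltac:(lra).
  have Lg := @H2_L2 g (x + x' - t) Hg ltac:(lra).
  under eq_integral do rewrite FE Normc.normcM normcJ.
  have := L2_young Lf Lg ltr01.
  move=> /le_trans; apply; rewrite lee_fin /K.
  have := @H2_nsq_le f t Hf ltac:(lra).
  have := @H2_nsq_le g (x + x' - t) Hg ltac:(lra).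
  by rewrite divr1; lra.
Qed.

(** If [m] rises by [d] over one step of length [s], midpoint convexity makes it rise by at least
    [d] over each following step of that length, so it grows linearly to the right and exceeds
    [K]. *)
Lemma midconvex_bounded_noninc (m : R -> R) K :
  (forall x s, 0 < s < x -> 2 * m x <= m (x - s) + m (x + s)) ->
  (forall x, 0 < x -> m x <= K) ->
  forall x y, 0 < x -> x <= y -> m y <= m x.
Proof.
move=> mc mK x y x0; rewrite le_eqVlt => /predU1P[->//|xy].
rewrite leNgt; apply/negP => mxy.
pose s := y - x; pose d := m y - m x.
have d0 : 0 < d by rewrite /d; lra.
have s0 : 0 < s by rewrite /s; lra.
have step n : d <= m (x + n.+1%:R * s) - m (x + n%:R * s).
  elim: n => [|n IH].
    by rewrite mul1r mul0r addr0 /s /d subrKC.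
  have n0 : 0 <= n%:R :> R by [].
  have := mc (x + n.+1%:R * s) s.
  rewrite (_ : x + n.+1%:R * s - s = x + n%:R * s); last by rewrite -natr1; ring.
  rewrite (_ : x + n.+1%:R * s + s = x + n.+2%:R * s); last by rewrite -!natr1; ring.
  rewrite s0 /= -natr1 => /(_ _).
  rewrite -natr1 in IH.
  have -> : s < x + (n%:R + 1) * s by nra.
  by move=> /(_ isT); lra.
have grow n : m x + n%:R * d <= m (x + n%:R * s).
  elim: n => [|n IH]; first by rewrite !mul0r !addr0.
  by have := step n; rewrite -!natr1 in IH *; lra.
have [n Hn] : exists n : nat, (K - m x) / d < n%:R.
  by exists (Num.truncn ((K - m x) / d)).+1; exact: truncnS_gt.
rewrite ltr_pdivrMr// in Hn.
have := grow n; have := mK (x + n%:R * s).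
have n0 : 0 <= n%:R * s by rewrite mulr_ge0// ltW.
rewrite ltr_wpDr// => /(_ isT); lra.
Qed.

Lemma H2_nsq_noninc f x y : H2 f -> 0 < x -> x <= y ->
  nsq (line f y) <= nsq (line f x).
Proof.
move=> Hf; apply: (@midconvex_bounded_noninc (fun x => nsq (line f x)) (pi * H2norm f ^+ 2)).
  move=> t s /andP[s0 st].
  (* Shifting by [s] brings the lines [t - s] and [t + s] together at [t], so the cross term in the
     nonnegative squared norm of the difference of the two restrictions is twice
     [nsq (line f t)]. *)
  have := @dotRe_shift f f (t - s) (t + s) s Hf Hf ltac:(lra) (ltW s0) ltac:(lra).
  rewrite subrK addrK dotRexx => E.
  have := nsqB (@H2_L2 f (t - s) Hf ltac:(lra)) (@H2_L2 f (t + s) Hf ltac:(lra)).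
  rewrite E; have := nsq_ge0 (fun y => line f (t - s) y - line f (t + s) y).
  lra.
by move=> t t0; exact: H2_nsq_le.
Qed.

(** By monotonicity an abscissa [r] that nearly attains the supremum is beaten by every smaller one,
    so the supremum is the limit at 0. *)
Lemma H2norm_lim f e : H2 f -> 0 < e -> exists2 r, 0 < r &
  forall x, 0 < x <= r -> `|H2norm f ^+ 2 - nsq (line f x) / pi| <= e.
Proof.
move=> Hf e0.
have fin : hardy_norm2 f \is a fin_num by rewrite H2normE.
have [_ [r r0 <-]] := ub_ereal_sup_adherent e0 fin.
rewrite -/(hardy_norm2 f) H2normE// L2_nsqE; last exact: H2_L2.
rewrite -EFinM -EFinB lte_fin => Hr; exists r => // x /andP[x0 xr].
have := H2_nsq_noninc Hf x0 xr; have := H2_nsq_le Hf x0.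
rewrite ler_distlC => K1 K2.
have p0 := pi_gt0 R.
have K3 : nsq (line f r) / pi <= nsq (line f x) / pi by rewrite ler_pM2r ?invr_gt0.
have K4 : nsq (line f x) / pi <= H2norm f ^+ 2 by rewrite ler_pdivrMr// mulrC.
by rewrite mulrC in Hr; apply/andP; split; lra.
Qed.

Lemma H2dot_polar_lim f g c e : H2 f -> H2 g -> 0 < e -> exists2 r, 0 < r &
  forall x, 0 < x <= r ->
    `|(H2norm (fun z => f z + c * g z) ^+ 2 -
       H2norm (fun z => f z + - c * g z) ^+ 2) / 4 -
      dotRe (line f x) (fun y => c * line g x y) / pi| <= e.
Proof.
move=> Hf Hg e0.
have [r1 r10 H1] := H2norm_lim (H2_comb c Hf Hg) e0.
have [r2 r20 H2] := H2norm_lim (H2_comb (- c) Hf Hg) e0.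
exists (Num.min r1 r2) => [|x]; first by rewrite lt_min r10.
rewrite le_min => /andP[x0 /andP[x1 x2]].
rewrite dotRe_polar; [|exact: H2_L2|by apply: L2Z; exact: H2_L2].
have xr1 : 0 < x <= r1 by rewrite x0.
have xr2 : 0 < x <= r2 by rewrite x0.
have E : line (fun z => f z + - c * g z) x = (fun y => line f x y - c * line g x y).
  by apply/funext => y; rewrite /line mulNr.
have close (N1 N2 n1 n2 : R) : `|N1 - n1 / pi| <= e -> `|N2 - n2 / pi| <= e ->
    `|(N1 - N2) / 4 - (n1 - n2) / 4 / pi| <= e.
  rewrite (_ : (n1 - n2) / 4 / pi = (n1 / pi - n2 / pi) / 4); last by ring.
  by rewrite !ler_norml => /andP[? ?] /andP[? ?]; apply/andP; split; lra.
rewrite -E; exact: close (H1 x xr1) (H2 x xr2).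
Qed.

(* The two halves of the polarization identity are the boundary values of
   Re int f g^* / pi and Re int f (i g)^* / pi = Im int f g^* / pi. *)
Lemma Re_H2dot_lim f g e : H2 f -> H2 g -> 0 < e -> exists2 r, 0 < r &
  forall x, 0 < x <= r ->
    `|Re (H2dot f g) - dotRe (line f x) (line g x) / pi| <= e.
Proof.
move=> Hf Hg e0; have [r r0 Hr] := H2dot_polar_lim 1 Hf Hg e0.
exists r => // x /Hr.
by have -> : (fun y => 1 * line g x y) = line g x by apply/funext => y; rewrite mul1r.
Qed.

Lemma Im_H2dot_lim f g e : H2 f -> H2 g -> 0 < e -> exists2 r, 0 < r &
  forall x, 0 < x <= r ->
    `|Im (H2dot f g) - dotRe (line f x) (line (fun z => 'i%C * g z) x) / pi| <= e.
Proof. exact: H2dot_polar_lim. Qed.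

Lemma limit_unique0 (k l : R) (h : R -> R) :
  (forall e, 0 < e -> exists2 r, 0 < r & forall x, 0 < x <= r -> `|k - h x| <= e) ->
  (forall e, 0 < e -> exists2 r, 0 < r & forall x, 0 < x <= r -> `|l - h x| <= e) ->
  k = l.
Proof.
move=> Hk Hl; apply/eqP; rewrite -subr_eq0 -normr_le0; apply/ler_addgt0Pr => e e0.
have e2 : 0 < e / 2 by rewrite divr_gt0.
have [r r0 Hr] := Hk _ e2; have [s s0 Hs] := Hl _ e2.
have m0 : 0 < Num.min r s by rewrite lt_min r0.
have := Hr (Num.min r s); have := Hs (Num.min r s).
rewrite m0 !ge_min !lexx orbT => /(_ isT) + /(_ isT).
by rewrite !ler_norml => /andP[? ?] /andP[? ?]; apply/andP; split; lra.
Qed.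

End Hardy.

(** * Translations of the half-plane and their adjoints *)

Section Translation.
Variable R : realType.
Local Notation C := R[i].
Local Notation mu := (@lebesgue_measure R).
Implicit Types (f g : C -> C) (z w b : C) (x y s c e : R) (u v : R -> C).

Lemma complexD (a b c d : R) : Complex a b + Complex c d = Complex (a + c) (b + d).
Proof. by []. Qed.

Lemma continuous_normc_sq u : continuous (fun y => Re (u y)) ->
  continuous (fun y => Im (u y)) -> continuous (fun y => normc (u y) ^+ 2).
Proof.
move=> cR cI; rewrite (_ : (fun y => _) = (fun y => Re (u y) * Re (u y) + Im (u y) * Im (u y))).
  by move=> y; apply: cvgD; [apply: cvgM; exact: cR|apply: cvgM; exact: cI].
by apply/funext => y; rewrite sqr_normc !expr2.
Qed.

Lemma nsq_translate u c : continuous (fun y => Re (u y)) ->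
  continuous (fun y => Im (u y)) -> nsq (fun y => u (y + c)) = nsq u.
Proof.
move=> cR cI; rewrite /nsq /Rintegral.
rewrite (@integral_translate _ (fun y => normc (u y) ^+ 2) c)//.
- exact: continuous_normc_sq.
- by move=> y; exact: sqr_ge0.
Qed.

Lemma H2_continuous_line f x : H2 f -> 0 < x ->
  continuous (fun y => Re (line f x y)) /\ continuous (fun y => Im (line f x y)).
Proof.
move=> Hf x0; split; apply: continuous_line; try by move=> y; exact: H2_cont.
- exact: Re_contract.
- exact: Im_contract.
Qed.

Lemma H2_translate f b : H2 f -> 0 <= Re b -> H2 (fun z => f (z + b)).
Proof.
move=> Hf b0; apply: (@H2_intro _ _ (pi * H2norm f ^+ 2)) => [z z0|x x0].
  have [|d Hd] := @H2_cdiff _ f (z + b) Hf; first by rewrite ReD; lra.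
  by exists d; exact: cdiff_shift.
have xb : 0 < x + Re b by lra.
have [cR cI] := H2_continuous_line Hf xb.
have := @integral_translate _ (fun y => normc (line f (x + Re b) y) ^+ 2) (Im b)
  (continuous_normc_sq cR cI) (fun y => sqr_ge0 _).
move=> E; rewrite [leLHS](_ : _ = \int[mu]_y (normc (line f (x + Re b) y) ^+ 2)%:E)%E.
  exact: H2_sqint.
by rewrite -E; apply: eq_integral => y _; rewrite /line; case: (b).
Qed.

(** Polarization reduces the signed integrand to squared norms, which are nonnegative and continuous
    as [integral_translate] requires. *)
Lemma dotRe_translate f g x x' c : H2 f -> H2 g -> 0 < x -> 0 < x' ->
  dotRe (fun y => line f x (y + c)) (fun y => line g x' (y + c)) =
  dotRe (line f x) (line g x').
Proof.
move=> Hf Hg x0 x'0.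
have Lt h t : H2 h -> 0 < t -> L2 (fun y => line h t (y + c)).
  move=> Hh t0; have := H2_L2 (@H2_translate h (Complex 0 c) Hh (lexx _)) t0.
  by congr L2; apply/funext => y; rewrite /line complexD addr0.
rewrite !dotRe_polar; try exact: H2_L2; try exact: Lt.
have [cRf cIf] := H2_continuous_line Hf x0; have [cRg cIg] := H2_continuous_line Hg x'0.
congr ((_ - _) / 4).
- apply: (@nsq_translate (fun y => line f x y + line g x' y)) => y.
  + by under eq_fun do rewrite ReD; apply: cvgD; [exact: cRf|exact: cRg].
  + by under eq_fun do rewrite ImD; apply: cvgD; [exact: cIf|exact: cIg].
- apply: (@nsq_translate (fun y => line f x y - line g x' y)) => y.
  + by under eq_fun do rewrite ReB; apply: cvgB; [exact: cRf|exact: cRg].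
  + by under eq_fun do rewrite ImB; apply: cvgB; [exact: cIf|exact: cIg].
Qed.

(** The imaginary part of [b] is absorbed by translating the line along itself, the real part by
    [dotRe_shift]. The identity is thus exact on each line, before any limit. *)
Lemma dotRe_adjoint f g b x : H2 f -> H2 g -> 0 <= Re b -> 0 < x ->
  dotRe (line (fun z => f (z + b)) x) (line g x) =
  dotRe (line f x) (line (fun z => g (z + conjc b)) x).
Proof.
case: b => b1 b2 Hf Hg /= b10 x0.
pose g2 z := g (z + Complex 0 (- b2)).
have Hg2 : H2 g2 by exact: H2_translate.
rewrite (_ : line (fun z => f (z + Complex b1 b2)) x =
  (fun y => line f (x + b1) (y + b2)))//.
rewrite (_ : line g x = (fun y => line g2 x (y + b2))); last first.
  by apply/funext => y; rewrite /line /g2 complexD addr0 addrK.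
rewrite dotRe_translate//; last lra.
have := @dotRe_shift _ f g2 x (x + b1) b1 Hf Hg2 x0 b10 ltac:(lra).
rewrite addrK => <-; congr dotRe; apply/funext => y.
by rewrite /line /g2 !complexD addr0.
Qed.

Lemma H2dot_translate f g b : H2 f -> H2 g -> 0 <= Re b ->
  H2dot (fun z => f (z + b)) g = H2dot f (fun z => g (z + conjc b)).
Proof.
move=> Hf Hg b0.
have b0' : 0 <= Re (conjc b) by case: (b) b0.
have Hfb := H2_translate Hf b0; have Hgb := H2_translate Hg b0'.
apply: complex_ext.
  apply: (@limit_unique0 _ _ _ (fun x => dotRe (line f x)
    (line (fun z => g (z + conjc b)) x) / pi)) => e e0.
    have [r r0 Hr] := Re_H2dot_lim Hfb Hg e0; exists r => // x xr.
    by rewrite -dotRe_adjoint//; [exact: Hr|case/andP: xr].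
  exact: Re_H2dot_lim.
apply: (@limit_unique0 _ _ _ (fun x => dotRe (line f x)
    (line (fun z => 'i%C * g (z + conjc b)) x) / pi)) => e e0.
  have [r r0 Hr] := Im_H2dot_lim Hfb Hg e0; exists r => // x xr.
  have /andP[x0 _] := xr.
  have := @dotRe_adjoint f (fun z => 'i%C * g z) b x Hf (H2Z 'i%C Hg) b0 x0.
  by move=> <-; exact: Hr.
exact: Im_H2dot_lim.
Qed.

Lemma H2norm_ext f f' : (forall z, 0 < Re z -> f z = f' z) -> H2norm f = H2norm f'.
Proof.
move=> E; rewrite /H2norm /hardy_norm2; congr (Num.sqrt (fine (ereal_sup _))).
apply: eq_imagel => x x0; congr (_ * _)%E; apply: eq_integral => y _.
by rewrite E.
Qed.

Lemma H2dot_ext f f' g g' : (forall z, 0 < Re z -> f z = f' z) ->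
  (forall z, 0 < Re z -> g z = g' z) -> H2dot f g = H2dot f' g'.
Proof.
move=> Ef Eg; rewrite /H2dot.
have E (c : C) : H2norm (fun z => f z + c * g z) = H2norm (fun z => f' z + c * g' z).
  by apply: H2norm_ext => z z0; rewrite Ef// Eg.
by rewrite !E.
Qed.

End Translation.

(** * Reproducing kernels *)

Section Kernel.
Variable R : realType.
Local Notation C := R[i].
Local Notation mu := (@lebesgue_measure R).
Implicit Types (f g h : C -> C) (z w a b p : C) (x y s c e t : R) (u v : R -> C).

Lemma integral_oneDsqrV : (\int[mu]_y (oneDsqr y)^-1%:E = pi%:E)%E.
Proof.
rewrite (@ge0_symfun_integralT _ (fun y => (oneDsqr y)^-1)).
- rewrite (_ : [set x : R | 0 <= x] = `[0, +oo[%classic); last by rewrite set_itvcy.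
  by rewrite integral0y_oneDsqr -EFinM; congr _%:E; field.
- by move=> y; rewrite invr_ge0 (le_trans ler01)// oneDsqr_ge1.
- exact: continuous_oneDsqrV.
- by move=> y; rewrite /= /oneDsqr sqrrN.
Qed.

Lemma integral_poisson s c : 0 < s ->
  (\int[mu]_y (s ^+ 2 + (y - c) ^+ 2)^-1%:E = (pi / s)%:E)%E.
Proof.
move=> s0; pose F y : R := s^-1 * y.
have dF (y : R) : is_derive y (1 : R) F s^-1.
  have := is_deriveZ s^-1 (is_derive_id y (1 : R)).
  by rewrite /GRing.scale/= mulr1.
have F' : (F^`())%classic = cst s^-1 by apply/funext => y; rewrite derive1E; exact: derive_val.
have sV0 : 0 < s^-1 by rewrite invr_gt0.
have cG : continuous (fun y : R => (s ^+ 2 + y ^+ 2)^-1).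
  move=> y; apply: cvgV.
    by rewrite gt_eqF// ltr_pwDl ?exprn_gt0 ?sqr_ge0.
  by apply: cvgD; [exact: cvg_cst|exact: exprn_continuous].
rewrite (@integral_translate _ (fun y => (s ^+ 2 + y ^+ 2)^-1) (- c))//; last first.
  by move=> y; rewrite invr_ge0 addr_ge0 ?sqr_ge0.
have := @increasing_ge0_integration_by_substitutionT _ F (fun y => (oneDsqr y)^-1).
rewrite integral_oneDsqrV F' => /(_ _ _ _ _ _ _ _ _ _)/esym E.
have {}E : (\int[mu]_y ((((fun y => (oneDsqr y)^-1) \o F) * cst s^-1) y)%:E = pi%:E)%E.
  apply: E.
  - by move=> x y xy; rewrite /F ltr_pM2l.
  - exact: cst_continuous.
  - exact: is_cvg_cst.
  - exact: is_cvg_cst.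
  - by move=> y; case: (dF y).
  - apply/cvgrNyPle => M; near=> y; rewrite /F mulrC ler_pdivrMr//; near: y;
    by apply: nbhs_ninfty_le; exact: num_real.
  - apply/cvgryPge => M; near=> y; rewrite /F mulrC ler_pdivlMr//; near: y;
    by apply: nbhs_pinfty_ge; exact: num_real.
  - exact: continuous_oneDsqrV.
  - by move=> y; rewrite invr_ge0 (le_trans ler01)// oneDsqr_ge1.
have -> : (pi / s)%:E = (s^-1%:E * pi%:E)%E by rewrite -EFinM mulrC.
rewrite -E -ge0_integralZl//.
- apply: eq_integral => y _; rewrite -EFinM; congr _%:E.
  rewrite [X in s^-1 * X](_ : _ = (1 + (s^-1 * y) ^+ 2)^-1 * s^-1)//.
  have ? : s != 0 by rewrite gt_eqF.
  have -> : s ^+ 2 + y ^+ 2 = s ^+ 2 * (1 + (s^-1 * y) ^+ 2) by field.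
  by move: (1 + _) => A; rewrite invfM -exprVn expr2 mulrAC mulrA.
- apply/measurable_EFinP; apply: measurable_funM => //.
  apply: continuous_measurable_fun => y.
  apply: (@continuous_comp _ _ _ F (fun y => (oneDsqr y)^-1)); last exact: continuous_oneDsqrV.
  by apply: differentiable_continuous; apply/derivable1_diffP; case: (dF y).
- by move=> y _; rewrite lee_fin mulr_ge0// ?invr_ge0 ?(le_trans ler01 (oneDsqr_ge1 _))// ltW.
- by rewrite lee_fin ltW.
Unshelve. all: end_near. Qed.

(** The restriction of a kernel to a vertical line at distance [s] from its pole. Its squared
    modulus is a Poisson kernel up to a factor, of integral [pi / s]: finite on each line and
    vanishing as the line recedes. With [s = 1] it also serves as an integrable majorant. *)
Definition inv_line s c y : C := (Complex s (y - c))^-1.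

Lemma normc_inv_line s c y : normc (inv_line s c y) ^+ 2 = (s ^+ 2 + (y - c) ^+ 2)^-1.
Proof. by rewrite Normc.normcV exprVn sqr_normc. Qed.

Lemma inv_line_L2 s c : 0 < s -> L2 (inv_line s c).
Proof.
move=> s0; pose f z : C := (z + Complex 0 (- c))^-1.
have fE y : f (Complex s y) = inv_line s c y by rewrite /f complexD addr0.
have cf y : ccont f (Complex s y).
  have [|d Hd] := @cdiffV _ (Complex s y + Complex 0 (- c)).
    by rewrite complexD addr0 eq_complex/= gt_eqF.
  by apply: cdiff_cont; exact: cdiff_shift Hd.
split.
- under eq_fun do rewrite -fE.
  by apply: continuous_measurable_fun; apply: continuous_line => // z w; exact: Re_contract.
- under eq_fun do rewrite -fE.
  by apply: continuous_measurable_fun; apply: continuous_line => // z w; exact: Im_contract.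
- by under eq_integral do rewrite normc_inv_line; rewrite integral_poisson ?ltry.
Qed.

Lemma nsq_inv_line s c : 0 < s -> nsq (inv_line s c) = pi / s.
Proof.
move=> s0; apply: EFin_inj; rewrite -L2_nsqE; last exact: inv_line_L2.
by under eq_integral do rewrite normc_inv_line; exact: integral_poisson.
Qed.

Definition kern a z : C := (z + conjc a)^-1.

Lemma line_kern a x : line (kern a) x = inv_line (x + Re a) (Im a).
Proof. by case: a => a1 a2; apply/funext => y; rewrite /line /kern /inv_line. Qed.

Lemma cdiff_kern a z : 0 < Re a -> 0 < Re z -> exists d, cdiff_at (kern a) z d.
Proof.
case: a => a1 a2 /= a0 z0; have [|d Hd] := @cdiffV _ (z + conjc (Complex a1 a2)).
  by case: z z0 => z1 z2 /= z0; rewrite eq_complex/= gt_eqF// addr_gt0.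
by exists d; exact: cdiff_shift Hd.
Qed.

Lemma H2_kern a : 0 < Re a -> H2 (kern a).
Proof.
move=> a0; apply: (@H2_intro _ _ (pi / Re a)) => [z z0|x x0]; first exact: cdiff_kern.
have xa : 0 < x + Re a by rewrite addr_gt0.
have := L2_nsqE (inv_line_L2 (Im a) xa); rewrite -line_kern /line => ->.
rewrite -/(line _ _) line_kern nsq_inv_line// lee_fin ler_pM2l ?pi_gt0//.
by rewrite lef_pV2 ?posrE// lerDr ltW.
Qed.

End Kernel.

(** * Evaluation at a point as a pairing with a kernel *)

Section Reproducing.
Variable R : realType.
Local Notation C := R[i].
Local Notation mu := (@lebesgue_measure R).
Implicit Types (f g h F G : C -> C) (z w a b p c : C) (x y s e t : R) (u v : R -> C).

Lemma cdiff_local F G z k e : 0 < e ->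
  (forall w, normc (w - z) <= e -> F w = G w) -> cdiff_at G z k -> cdiff_at F z k.
Proof.
move=> e0 FG H eps eps0; have [r r0 Hr] := H eps eps0.
exists (Num.min r e); first by rewrite lt_min r0.
move=> w; rewrite le_min => /andP[wr we]; rewrite !FG//; first exact: Hr.
by rewrite subrr Normc.normc0 ltW.
Qed.

(** For [h p = 0] and [d] the derivative of [h] at [p], this is [h z / (p - z)] with its removable
    singularity filled in. The product with [- 1] and [z + - p] has the shape produced by [cdiffM]
    and [cdiff_shift]. *)
Definition diff_quot h d p z : C :=
  if z == p then - d else (- 1 * h z) * (z + - p)^-1.

Lemma diff_quot_cont h d p : h p = 0 -> cdiff_at h p d -> ccont (diff_quot h d p) p.
Proof.
move=> hp H e e0; have [r r0 Hr] := H e e0; exists r => // w wr.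
rewrite /diff_quot eqxx; case: eqVneq => [_|wp].
  by rewrite subrr Normc.normc0 ltW.
have wp0 : w - p != 0 by rewrite subr_eq0.
have -> : -1 * h w * (w + - p)^-1 - - d = - (h w - h p - d * (w - p)) * (w - p)^-1.
  by rewrite hp; field.
by rewrite Normc.normcM Normc.normcV normcN ler_pdivrMr ?normc_gt0//; exact: Hr.
Qed.

Lemma diff_quot_cdiff h d p z : (exists k, cdiff_at h z k) -> z <> p ->
  exists k, cdiff_at (diff_quot h d p) z k.
Proof.
move=> [k Hk] zp.
have zp0 : z + - p != 0 by rewrite subr_eq0; apply/eqP.
have [l Hl] := cdiffV zp0.
eexists; apply: (@cdiff_local _ (fun z => (- 1 * h z) * (z + - p)^-1) _ _ (normc (z - p) / 2)).
- by rewrite divr_gt0 ?normc_gt0.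
- move=> w wz; rewrite /diff_quot; case: eqVneq => // wp.
  have := normc_gt0 (z - p); rewrite zp0 => n0.
  by exfalso; move: wz n0; rewrite wp normcB; clear; lra.
- apply: cdiffM; last exact: cdiff_shift Hl.
  by apply: cdiffM; [exact: cdiff_cst|exact: Hk].
Qed.

Lemma invr_le_half (D : R) : 1 < D -> D^-1 <= 2 / (1 + D).
Proof.
move=> D1; have D0 : 0 < D by lra.
rewrite ler_pdivlMr; last lra.
rewrite mulrC ler_pdivrMr//; lra.
Qed.

(** Cauchy's theorem needs one integral bound for all lines of the strip, including the line through
    [p], where the inverse factor is not square-integrable. Heights within 1 of [p] are handled by
    compactness, the others by the mean inequality between [h] and the inverse factor. *)
Lemma diff_quot_bound h d p x X :
  (forall z, x <= Re z <= X -> ccont (diff_quot h d p) z) ->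
  x <= X -> exists2 M, 0 < M & forall t y, x <= t <= X ->
  normc (diff_quot h d p (Complex t y)) <=
    normc (line h t y) ^+ 2 + M * normc (inv_line 1 (Im p) y) ^+ 2.
Proof.
move=> cF xX.
have [M M0 HM] := jcont_bounded x X (Im p - 1) (Im p + 1)
  (jcont_strip (@normc_contract R) xX cF).
(* Near [p] one has [1 + D <= 2], so [M] is at most [2 * M / (1 + D)]; away from it [D^-1] is at
   most [2 / (1 + D)]. The constant adds the two numerators. *)
exists (2 * M + 2) => [|t y tI]; first by lra.
rewrite normc_inv_line expr1n.
set D := (y - Im p) ^+ 2.
have D0 : 0 <= D by exact: sqr_ge0.
have h0 : 0 <= normc (line h t y) ^+ 2 by exact: sqr_ge0.
have [yp|yp] := leP `|y - Im p| 1.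
  have D1 : D <= 1 by rewrite -(@expr1n R 2) /D -[_ ^+ 2]real_normK ?num_real// lerXn2r ?nnegrE.
  have := HM t y tI; rewrite clamp_id// ger0_norm ?normc_ge0// => /(_ _) H.
  apply: (@le_trans _ _ M).
    by apply: H; move: yp; rewrite ler_norml => /andP[? ?]; apply/andP; split; lra.
  rewrite -[leLHS]add0r lerD// ler_pdivlMr; last lra.
  nra.
have D1 : 1 < D by rewrite /D -[_ ^+ 2]real_normK ?num_real// expr2; nra.
rewrite /diff_quot ifF; last first.
  by apply/eqP => E; move: yp; rewrite -E/= subrr normr0 ltr10.
rewrite !Normc.normcM normcN Normc.normc1 mul1r Normc.normcV.
set n := normc (_ + - p).
have nD : D <= n ^+ 2 by rewrite /n sqr_normc ReB ImB/= lerDr sqr_ge0.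
have := young (normc (line h t y)) n^-1 (@ltr01 R).
rewrite -/(line h t y) mul1r divr1 exprVn => /le_trans; apply.
have n2 : (n ^+ 2)^-1 <= D^-1 by rewrite lef_pV2 ?posrE//; lra.
have DD : D^-1 <= 2 / (1 + D) := invr_le_half D1.
have M2 : 0 <= 2 * M / (1 + D) by rewrite divr_ge0//; lra.
rewrite [X in _ <= _ + X]mulrDl.
have n20 : 0 <= n ^- 2 by rewrite invr_ge0 sqr_ge0.
lra.
Qed.

(* By Cauchy's theorem the line can be pushed to Re z = oo, across the zero of
   [h] that cancels the pole of the kernel. *)
Lemma kern_orth h a x : H2 h -> 0 < Re a -> 0 < x ->
  h (Complex (Re a + 2 * x) (Im a)) = 0 ->
  dotRe (line h x) (line (kern a) x) = 0.
Proof.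
move=> Hh a0 x0; set p := Complex _ _ => hp.
have p0 : 0 < Re p by rewrite /=; lra.
have [d Hd] := H2_cdiff Hh p0.
(* On [Re z = x] one has [conjc z = 2 * x - z], so the conjugate of [kern a z] is [(p - z)^-1] and
   the integrand of the pairing is the real part of [F]. *)
pose F := diff_quot h d p.
have dF z : 0 < Re z -> z <> p -> exists k, cdiff_at F z k.
  by move=> z0; apply: diff_quot_cdiff; exact: H2_cdiff.
have cF z : 0 < Re z -> ccont F z.
  move=> z0; have [->|/eqP zp] := eqVneq z p; first exact: diff_quot_cont.
  by have [k] := dF z z0 zp; exact: cdiff_cont.
have FI t : t != Re p -> forall y, F (Complex t y) =
    h (Complex t y) * (Complex (Re p - t) (Im a - y))^-1.
  move=> tp y; rewrite /F /diff_quot ifF; last first.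
    by apply/eqP => E; rewrite -E eqxx in tp.
  rewrite (_ : Complex t y + - p = - Complex (Re p - t) (Im a - y)).
    by rewrite invrN mulrN mulN1r mulNr opprK.
  by apply/eqP; rewrite eq_complex/= !opprB !eqxx.
have xE : dotRe (line h x) (line (kern a) x) = \int[mu]_y Re (F (Complex x y)).
  apply: eq_Rintegral => y _; rewrite FI; last by rewrite lt_eqF//=; lra.
  rewrite /line /kern; congr (Re (_ * _)); rewrite conjc_inv; congr (_^-1).
  by rewrite /p; case: (a) => a1 a2; apply/eqP; rewrite eq_complex/=;
    apply/andP; split; apply/eqP; ring.
have bound X : x <= X -> exists K, forall t, x <= t <= X ->
    (\int[mu]_y (normc (F (Complex t y)))%:E <= K%:E)%E.
  move=> xX.
  have [|M M0 HM] := @diff_quot_bound h d p x X _ xX.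
    by move=> z zI; apply: cF; lra.
  exists (pi * H2norm h ^+ 2 + M * (pi / 1)) => t tI.
  have t0 : 0 < t by lra.
  have Lh := H2_L2 Hh t0; have Li := inv_line_L2 (Im p) (@ltr01 R).
  have ih := L2_integrable_sq Lh; have ii := L2_integrable_sq Li.
  apply: (@le_trans _ _ (\int[mu]_y
      (normc (line h t y) ^+ 2 + M * normc (inv_line 1 (Im p) y) ^+ 2)%:E)%E).
    apply: ge0_le_integral => //.
    - by move=> y _; rewrite lee_fin normc_ge0.
    - apply/measurable_EFinP; apply: continuous_measurable_fun.
      apply: continuous_line; first exact: normc_contract.
      by move=> y; exact: cF.
    - apply/measurable_EFinP; apply: measurable_funD; first exact: L2_measurable_sq.
      by apply: measurable_funM => //; exact: L2_measurable_sq.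
    - by move=> y _; rewrite lee_fin; exact: HM.
  under eq_integral do rewrite EFinD (EFinM M).
  rewrite integralD//; last exact: integrableZl.
  rewrite integralZl// L2_nsqE// L2_nsqE// nsq_inv_line// -EFinM -EFinD lee_fin.
  by rewrite lerD2r; exact: H2_nsq_le.
have shift X : x <= X ->
    \int[mu]_y Re (F (Complex x y)) = \int[mu]_y Re (F (Complex X y)).
  move=> xX; have [K HK] := bound X xX.
  apply: (@Re_integral_line_eq _ F x X p K xX) => //.
    by move=> z zI; apply: cF; lra.
  by move=> z zI; apply: dF; lra.
have far X t : x <= X -> Re p < X -> 0 < t ->
    `|\int[mu]_y Re (F (Complex X y))| <=
      (t * (pi * H2norm h ^+ 2) + pi / (X - Re p) / t) / 2.
  move=> xX pX t0; have [K HK] := bound X xX.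
  have X0 : 0 < X by lra.
  have cX y : ccont F (Complex X y) by exact: cF.
  have Xp : 0 < X - Re p by lra.
  have invE y : normc (Complex (Re p - X) (Im a - y))^-1 =
      normc (inv_line (X - Re p) (Im p) y).
    rewrite /inv_line !Normc.normcV -normcN; congr (normc _)^-1.
    by apply/eqP; rewrite eq_complex/= !opprB !eqxx.
  have iF := integrable_line (@Re_contract R) (@normc_Re R) cX (HK X ltac:(lra)).
  have Lh := H2_L2 Hh X0; have Li := inv_line_L2 (Im p) Xp.
  rewrite -lee_fin EFin_normr_Rintegral//.
  apply: le_trans (le_abse_integral _ measurableT (measurable_int _ iF)) _.
  apply: (@le_trans _ _ ((t * nsq (line h X) + nsq (inv_line (X - Re p) (Im p)) / t) / 2)%:E).
    apply: le_trans (L2_young Lh Li t0).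
    apply: ge0_le_integral => //.
    - by apply: measurableT_comp => //; exact: measurable_int iF.
    - by apply/measurable_EFinP; apply: measurable_funM; exact: L2_measurable_norm.
    - move=> y _ /=; rewrite lee_fin; apply: le_trans (normc_Re _) _.
      by rewrite FI ?gt_eqF// Normc.normcM invE.
  rewrite lee_fin nsq_inv_line// ler_pM2r ?invr_gt0// lerD2r ler_pM2l//.
  exact: H2_nsq_le.
rewrite xE; apply/eqP; rewrite -normr_le0; apply/ler_addgt0Pr => e e0; rewrite add0r.
pose N := pi * H2norm h ^+ 2.
have N0 : 0 <= N by rewrite mulr_ge0 ?pi_ge0 ?sqr_ge0.
(* [t] gives [t * N <= e], and [X] is then placed so that [pi / (X - Re p) / t] is exactly [e]; the
   bound [far] becomes at most [e]. *)
pose t := e / (N + 1).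
have t0 : 0 < t by rewrite divr_gt0//; lra.
pose X := Re p + pi / (t * e).
have Xp : 0 < pi / (t * e) by rewrite divr_gt0 ?pi_gt0// mulr_gt0.
have xX : x <= X by rewrite /X /=; lra.
rewrite (shift X xX); apply: le_trans (@far X t xX _ t0) _; first by rewrite /X ltrDl.
rewrite -/N (_ : X - Re p = pi / (t * e)); last by rewrite /X addrC addKr.
have -> : pi / (pi / (t * e)) / t = e.
  have cancel (q u v : R) : 0 < q -> 0 < u -> 0 < v -> q / (q / (u * v)) / u = v.
    by move=> q0 u0 v0; field; rewrite !gt_eqF.
  by apply: cancel => //; exact: pi_gt0.
have : t * N <= e by rewrite /t mulrAC ler_pdivrMr; nra.
lra.
Qed.

Lemma dotReDl u u' v : L2 u -> L2 u' -> L2 v ->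
  dotRe (fun y => u y + u' y) v = dotRe u v + dotRe u' v.
Proof.
move=> Lu Lu' Lv; rewrite /dotRe -RintegralD//; try exact: L2_integrable_dot.
by apply: eq_Rintegral => y _; rewrite mulrDl ReD.
Qed.

Lemma dotReZ_self c u : L2 u -> dotRe (fun y => c * u y) u = Re c * nsq u.
Proof.
move=> Lu; rewrite /dotRe /nsq -RintegralZl//; last exact: L2_integrable_sq.
apply: eq_Rintegral => y _; rewrite Re_mulJ sqr_normc.
by case: (c) => c1 c2; case: (u y) => a b /=; ring.
Qed.

(** [kern a] takes the value [1 / (2 * (Re a + x))] at [p], so [f] minus [c] times the kernel
    vanishes there and [kern_orth] applies. What remains is [Re c] times the squared norm
    [pi / (x + Re a)], in which [Re a + x] cancels. *)
Lemma kern_reproducing_line f a x : H2 f -> 0 < Re a -> 0 < x ->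
  dotRe (line f x) (line (kern a) x) =
  2 * pi * Re (f (Complex (Re a + 2 * x) (Im a))).
Proof.
move=> Hf a0 x0; set p := Complex _ _.
pose c := f p * Complex (2 * (Re a + x)) 0.
have Hk := H2_kern a0.
have E : (p + conjc a) = Complex (2 * (Re a + x)) 0.
  by rewrite /p; case: (a) => a1 a2; apply/eqP; rewrite eq_complex/=;
    apply/andP; split; apply/eqP; ring.
have hp : f p + - c * kern a p = 0.
  rewrite /kern E mulNr /c mulfK ?subrr// eq_complex/= negb_and gt_eqF//.
  by rewrite mulr_gt0// addr_gt0.
have := @kern_orth (fun z => f z + - c * kern a z) a x (H2_comb (- c) Hf Hk) a0 x0 hp.
have xa : 0 < x + Re a by lra.
have Lf := H2_L2 Hf x0; have Lk := H2_L2 Hk x0.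
have := dotReDl Lf (L2Z (- c) Lk) Lk.
rewrite dotReZ_self// line_kern nsq_inv_line// -line_kern => E1 E2.
have {E1 E2} : dotRe (line f x) (line (kern a) x) + Re (- c) * (pi / (x + Re a)) = 0.
  by rewrite -E1.
rewrite (_ : Re (- c) = - (Re (f p) * (2 * (Re a + x)))); last first.
  by rewrite /c; case: (f p) => u v /=; rewrite mulr0 subr0.
move=> /eqP; rewrite addr_eq0 => /eqP ->.
by field; rewrite gt_eqF.
Qed.

(** As [x] tends to 0 the evaluation point in [kern_reproducing_line] tends to [a], an interior
    point, so continuity of [f] there is enough. *)
Lemma H2dot_kern f a : H2 f -> 0 < Re a ->
  H2dot f (kern a) = Complex (2 * Re (f a)) (2 * Im (f a)).
Proof.
move=> Hf a0; have Hk := H2_kern a0.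
have lim g : H2 g -> forall e, 0 < e -> exists2 r, 0 < r & forall x, 0 < x <= r ->
    `|2 * Re (g a) - dotRe (line g x) (line (kern a) x) / pi| <= e.
  move=> Hg e e0; have [r r0 Hr] := H2_cont Hg a0 (divr_gt0 e0 (ltr0n R 2)).
  exists (r / 2) => [|x /andP[x0 xr]]; first by rewrite divr_gt0.
  rewrite kern_reproducing_line//.
  set v := Re (g (Complex _ _)).
  have -> : 2 * pi * v / pi = 2 * v by rewrite mulrAC mulfK// gt_eqF// pi_gt0.
  rewrite /v.
  have := Hr (Complex (Re a + 2 * x) (Im a)).
  have -> : Complex (Re a + 2 * x) (Im a) - a = Complex (2 * x) 0.
    by case: (a) => a1 a2; apply/eqP; rewrite eq_complex/=;
    apply/andP; split; apply/eqP; ring.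
  rewrite /= expr0n addr0 sqrtr_sqr ger0_norm; last lra.
  move=> /(_ ltac:(lra)); have := Re_contract (g (Complex (Re a + 2 * x) (Im a))) (g a).
  move=> /le_trans H /H; rewrite !ler_norml => /andP[? ?]; apply/andP; split; lra.
apply: complex_ext.
  apply: (@limit_unique0 _ _ _ (fun x => dotRe (line f x) (line (kern a) x) / pi)) => e e0.
    exact: Re_H2dot_lim.
  exact: lim.
(* Moving i across the pairing turns the imaginary part for [f] into the real part for [- i * f],
   whose value at [a] has real part [Im (f a)]. *)
apply: (@limit_unique0 _ _ _
    (fun x => dotRe (line (fun z => - 'i%C * f z) x) (line (kern a) x) / pi)) => e e0.
  have [r r0 Hr] := Im_H2dot_lim Hf Hk e0; exists r => // x xr.
  have <- : dotRe (line f x) (line (fun z => 'i%C * kern a z) x) =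
      dotRe (line (fun z => - 'i%C * f z) x) (line (kern a) x).
    apply: eq_Rintegral => y _; rewrite !Re_mulJ /line.
    by case: (f _) => f1 f2; case: (kern a _) => k1 k2 /=; ring.
  exact: Hr.
have := lim _ (H2Z (- 'i%C) Hf) e e0.
have -> : Re (- 'i%C * f a) = Im (f a) by case: (f a) => f1 f2 /=; ring.
by [].
Qed.

(** Read off on the lines: [dotRe] is symmetric, and moving the factor i from one argument to the
    other changes the sign. *)
Lemma H2dotC f g : H2 f -> H2 g -> H2dot g f = conjc (H2dot f g).
Proof.
move=> Hf Hg.
have [ReJ ImJ] : (forall z, Re (conjc z) = Re z) /\ (forall z, Im (conjc z) = - Im z).
  by split=> -[].
apply: complex_ext; rewrite ?ReJ ?ImJ.
  apply: (@limit_unique0 _ _ _ (fun x => dotRe (line g x) (line f x) / pi)) => e e0.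
    exact: Re_H2dot_lim.
  have [r r0 Hr] := Re_H2dot_lim Hf Hg e0; exists r => // x xr.
  by rewrite dotReC; exact: Hr.
apply: (@limit_unique0 _ _ _
    (fun x => dotRe (line g x) (line (fun z => 'i%C * f z) x) / pi)) => e e0.
  exact: Im_H2dot_lim.
have [r r0 Hr] := Im_H2dot_lim Hf Hg e0; exists r => // x xr.
have /andP[x0 _] := xr.
have -> : dotRe (line g x) (line (fun z => 'i%C * f z) x) =
    - dotRe (line f x) (line (fun z => 'i%C * g z) x).
  rewrite -mulN1r /dotRe -RintegralZl//; last first.
    exact: L2_integrable_dot (H2_L2 Hf x0) (H2_L2 (H2Z 'i%C Hg) x0).
  apply: eq_Rintegral => y _; rewrite !Re_mulJ /line.
  by case: (f _) => f1 f2; case: (g _) => k1 k2 /=; ring.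
by rewrite mulNr opprK addrC -opprB normrN; exact: Hr.
Qed.

End Reproducing.

(** * The functional equation satisfied by a J-symmetric symbol *)

Theorem theorem4p1 (R : realType) (phi : R[i] -> R[i])
    (phi_analytic : analytic_on_Cplus phi)
    (phi_self_map : forall w, Cplus w -> Cplus (phi w))
    (phi_not_id : exists2 w, Cplus w & phi w <> w)
    (phi_bounded : H2bounded (comp_op phi)) :
  symmetric_wrt (@J R) (comp_op phi) <-> parabolic phi.
Proof.
have ReJ (z : R[i]) : Re (conjc z) = Re z by case: z.
split=> [[S [S_H2 S_adj] S_sym]|[b [b0 _ phiE]]]; last first.
  have J_involutive (f : R[i] -> R[i]) w :
      J (fun z => J f (z + conjc b)) w = f (w + b).
    by rewrite /J conjcD !conjcK.
  exists (fun g z => g (z + conjc b)).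
    split=> [f Hf|f g Hf Hg]; first by apply: H2_translate => //; rewrite ReJ.
    transitivity (H2dot (fun z => f (z + b)) g); last exact: H2dot_translate.
    by apply: H2dot_ext => // z z0; rewrite /comp_op /= phiE.
  by move=> f w _ w0; rewrite J_involutive /comp_op /= phiE.
have key a b : 0 < Re a -> 0 < Re b -> phi b + conjc a = phi (conjc a) + b.
  move=> a0 b0; have cb0 : 0 < Re (conjc b) by rewrite ReJ.
  have ca0 : 0 < Re (conjc a) by rewrite ReJ.
  have Ha := H2_kern a0; have Hb := H2_kern b0.
  have Jkern : J (kern (conjc b)) = kern b.
    by apply/funext => w; rewrite /J /kern conjc_inv conjcD !conjcK.
  (* Symmetry is tested on the kernel at [conjc b], which [J] sends to [kern b], and evaluated at
     [conjc a]: this computes the conjugate of [S (kern b) a]. The adjoint relation on [kern a] and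
     [kern b] computes the same number as [kern a (phi b)]. *)
  have := S_sym _ _ (H2_kern cb0) ca0; rewrite Jkern /J conjcK => E1.
  have adj := etrans (S_adj _ _ Ha Hb) (H2dotC (S_H2 _ Hb) Ha).
  have := etrans (esym (H2dot_kern (phi_bounded.1 _ Ha) b0))
    (etrans adj (congr1 conjc (H2dot_kern (S_H2 _ Hb) a0))).
  have ReImE (z w : R[i]) :
      Complex (2 * Re z) (2 * Im z) = conjc (Complex (2 * Re w) (2 * Im w)) ->
      z = conjc w.
    case: z => z1 z2; case: w => w1 w2 /= /eqP.
    by rewrite eq_complex/= => /andP[/eqP E /eqP E']; congr Complex; lra.
  move=> /ReImE; rewrite E1 /comp_op /kern /= conjcK.
  (* With the convention [0^-1 = 0], inversion is injective on all of C, so the denominators can be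
     compared directly. *)
  by move=> /invr_inj.
have phiE w : Cplus w -> phi w = w + (phi 1 - 1).
  move=> w0; have := key 1 w ltr01 w0; rewrite conjc1 => /eqP.
  by rewrite -subr_eq => /eqP <-; ring.
exists (phi 1 - 1); split => //.
  rewrite leNgt; apply/negP => c0.
  set c := phi 1 - 1 in phiE c0.
  (* A translation with [Re c < 0] carries this point, of abscissa [- Re c / 2], to abscissa
     [Re c / 2], outside the half-plane. *)
  have w0 : Cplus (Complex (- Re c / 2) 0) by rewrite /Cplus /=; lra.
  have := phi_self_map _ w0; rewrite phiE// /Cplus /=.
  by case: (c) c0 => c1 c2 /=; lra.
(* The identity map also gives a J-symmetric operator, so symmetry alone cannot exclude a zero
   translation; [phi_not_id] does. *)
by move=> c0; case: phi_not_id => w w0; rewrite phiE// c0 addr0.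
Qed.
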